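(* If $\Lambda$ is a loose Legendrian submanifold of $\mathbb{C}^n\times\mathbb{R}$, then its front $S^m$-spun $\Sigma_{S^m}\Lambda$ is a loose Legendrian submanifold of $\mathbb{C}^{n+m}\times\mathbb{R}$.
   Context: $\mathbb{C}^n\times\mathbb{R}$ carries the contact form $dz-\sum y_i\,dx_i$; the front projection is $\Pi_F(x_1,y_1,\dots,x_n,y_n,z)=(x_1,\dots,x_n,z)$, and a Legendrian is recovered from its front. Legendrian submanifolds are assumed closed, orientable and connected. Front $S^m$-spinning ($m\ge1$). After a translation assume the coordinate $x_n$ is positive on $\Lambda$. Then $\Sigma_{S^m}\Lambda\subset\mathbb{C}^{n+m}\times\mathbb{R}$ is the Legendrian embedding of $\Lambda\times S^m$ whose front projection is parametrized by \[(p,\sigma)\mapsto\big(x_1(p),\dots,x_{n-1}(p),\,x_n(p)\,\sigma,\,z(p)\big)\in\mathbb{R}^{n-1}\times\mathbb{R}^{m+1}\times\mathbb{R},\qquad p\in\Lambda,\ \sigma\in S^m\subset\mathbb{R}^{m+1},\] where $S^m$ is the unit sphere. Looseness (in $\mathbb{C}^n\times\mathbb{R}$, $n>1$; write the coordinates here as $(x,y,x_1,y_1,\dots,x_{n-1},y_{n-1},z)$). For $a,b,c>0$ let \[R^{n-1}_{abc}=\{(x,y,x_1,\dots,y_{n-1},z):|x|,|y|\le1,\ \|(x_1,\dots,x_{n-1})\|\le b,\ \|(y_1,\dots,y_{n-1})\|\le c,\ |z|\le a\}\] inside $(\mathbb{C}^n\times\mathbb{R},\,dz-y\,dx-\sum_i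 y_i\,dx_i)$. Let $\Lambda_0\subset R^{n-1}_{abc}$ be the product of $\{y_1=\dots=y_{n-1}=0,\ \|(x_1,\dots,x_{n-1})\|\le b\}$ with a Legendrian arc $\lambda_0\subset Q_a=\{|x|\le1,|y|\le1,|z|\le a\}\subset(\mathbb{R}^3,\ker(dz-y\,dx))$ with $\partial\lambda_0\subset\partial Q_a$, whose front projection to the $(x,z)$-plane is a stabilization zig-zag (the local picture of a stabilized Legendrian strand) with all slopes $y=dz/dx$ in $[-1,1]$. If $a<bc$, the pair $(R^{n-1}_{abc},\Lambda_0)$ is called a standard loose chart. A Legendrian $\Lambda\subset\mathbb{C}^n\times\mathbb{R}$ is loose if there is a subset $U\subset\mathbb{C}^n\times\mathbb{R}$ such that the pair $(U,U\cap\Lambda)$ is contactomorphic to a standard loose chart $(R^{n-1}_{abc},\Lambda_0)$ with $a<bc$. *)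

(* Defs.v *)
From HB Require Import structures.
From mathcomp Require Import all_boot all_order all_algebra.
From mathcomp Require Import all_classical all_reals all_analysis.
Set Implicit Arguments.
Unset Strict Implicit.
Unset Printing Implicit Defensive.
Import Order.TTheory GRing.Theory Num.Theory.
Import numFieldNormedType.Exports.
Local Open Scope ring_scope.
Local Open Scope classical_set_scope.

(** * Euclidean product; the library norm on ['rV_n] is the sup norm *)

Definition dot (R : realType) (n : nat) (u v : 'rV[R]_n) : R :=
  \sum_i u 0 i * v 0 i.

Definition enorm (R : realType) (n : nat) (u : 'rV[R]_n) : R :=
  Num.sqrt (dot u u).

(** * Smooth maps and diffeomorphisms between subsets of normed spaces *)

(** [V] is finite dimensional in every use, so that differentiability together
    with [C^k] directional derivatives is the usual [C^k.+1]. *)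
Fixpoint cont_diff (R : realType) (V W : normedModType R) (k : nat)
    (O : set V) (f : V -> W) : Prop :=
  if k is k'.+1 then
    (forall p, O p -> differentiable f p) /\
    (forall v : V, cont_diff k' O (fun p => 'D_v f p : W))
  else forall p, O p -> {for p, continuous f}.

(** Smoothness on an arbitrary subset: [f] is itself smooth on a neighbourhood.
    The values of [f] away from [A] are immaterial otherwise. *)
Definition smooth_on (R : realType) (V W : normedModType R)
    (A : set V) (f : V -> W) : Prop :=
  exists O : set V, [/\ open O, A `<=` O & forall k, cont_diff k O f].

Definition diffeo (R : realType) (V W : normedModType R)
    (A : set V) (B : set W) (F : V -> W) (G : W -> V) : Prop :=
  [/\ smooth_on A F, smooth_on B G, F @` A = B &
      forall p, A p -> G (F p) = p].

(** * Embedded submanifolds *)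

(** The data of a parametrization, with an inverse, of the part of a subset of
    [V] lying in [pimg]. *)
Record param (R : realType) (d : nat) (V : normedModType R) := Param {
  pdom : set 'rV[R]_d;
  pimg : set V;
  pmap : 'rV[R]_d -> V;
  pinv : V -> 'rV[R]_d }.

Definition is_param (R : realType) (d : nat) (V : normedModType R)
    (L : set V) (c : param d V) : Prop :=
  [/\ open (pdom c), open (pimg c) &
      diffeo (pdom c) (L `&` pimg c) (pmap c) (pinv c)].

Definition submanifold (R : realType) (d : nat) (V : normedModType R)
    (L : set V) : Prop :=
  forall p, L p -> exists c : param d V, is_param L c /\ pimg c p.

Definition tangent (R : realType) (d : nat) (V : normedModType R)
    (L : set V) (p w : V) : Prop :=
  exists (c : param d V) (u h : 'rV[R]_d),
    [/\ is_param L c, pdom c u, pmap c u = p & w = 'd (pmap c) u h].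

Definition orientable (R : realType) (d : nat) (V : normedModType R)
    (L : set V) : Prop :=
  exists A : set (param d V),
    [/\ forall c, A c -> is_param L c,
        forall p, L p -> exists c, A c /\ pimg c p &
        forall c c' u, A c -> A c' -> pdom c u -> pimg c' (pmap c u) ->
          0 < \det (jacobian (pinv c' \o pmap c) u)].

(** * Contact geometry *)

(** [C^n x R], with points [(x, y, z)]. *)
Definition cspace (R : realType) (n : nat) : normedModType R :=
  ('rV[R]_n * 'rV[R]_n * R)%type.

(** [dz - \sum_i y_i dx_i] at [p], evaluated on [w]. *)
Definition cform (R : realType) (n : nat) (p w : cspace R n) : R :=
  w.2 - dot p.1.2 w.1.1.

Definition front (R : realType) (n : nat) (p : cspace R n) : 'rV[R]_n * R :=
  (p.1.1, p.2).

(** "Closed" is compact without boundary; [submanifold] allows no boundary. *)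
Definition legendrian (R : realType) (n : nat) (L : set (cspace R n)) : Prop :=
  [/\ submanifold n L, compact L, connected L, orientable n L &
      forall p w, L p -> tangent n L p w -> cform p w = 0].

(** A contactomorphism from the pair [(A, A0)] onto the pair [(B, B0)], for the
    contact structures [ker alpha] and [ker beta]. *)
Definition contactomorphism (R : realType) (V W : normedModType R)
    (alpha : V -> V -> R) (beta : W -> W -> R)
    (A A0 : set V) (B B0 : set W) (F : V -> W) (G : W -> V) : Prop :=
  [/\ diffeo A B F G, F @` A0 = B0 &
      forall p v, A p -> (alpha p v = 0 <-> beta (F p) ('d F p v) = 0)].

Definition contactomorphic (R : realType) (V W : normedModType R)
    (alpha : V -> V -> R) (beta : W -> W -> R)
    (A A0 : set V) (B B0 : set W) : Prop :=
  exists (F : V -> W) (G : W -> V), contactomorphism alpha beta A A0 B B0 F G.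

(** * Loose charts *)

Definition cubeQ (R : realType) (a : R) : set (R * R * R) :=
  [set q | [/\ `|q.1.1| <= 1, `|q.1.2| <= 1 & `|q.2| <= a]].

(** A Legendrian arc [(x, y, z)] of [dz - y dx] in the cube [cubeQ a], with
    endpoints on the boundary, whose front is a zig-zag: it goes right up to a
    cusp at [t1], left up to a cusp at [t2], then right again. The cusps are
    semicubical. The front has no self-intersection and its two outer strands
    extend beyond the cusps: this is what distinguishes a stabilization (of
    either sign) from a front of the first Reidemeister move. The derivatives
    of [y] at the cusps make the arc immersed. *)
Definition zigzag_param (R : realType) (a : R) (x y z : R -> R) (t1 t2 : R)
    : Prop :=
  let I : set R := `[0, 1] in
  [/\ [/\ smooth_on I x, smooth_on I y & smooth_on I z],
      [/\ forall t, I t -> cubeQ a (x t, y t, z t),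
          ~ (cubeQ a)° (x 0, y 0, z 0), ~ (cubeQ a)° (x 1, y 1, z 1) &
          forall t, I t -> derive1 z t = y t * derive1 x t],
      [/\ 0 < t1, t1 < t2, t2 < 1,
          forall t, 0 <= t < t1 \/ t2 < t <= 1 -> 0 < derive1 x t &
          forall t, t1 < t < t2 -> derive1 x t < 0],
      [/\ derive1n 2 x t1 != 0, derive1n 2 x t2 != 0, derive1 y t1 != 0 &
          derive1 y t2 != 0] &
      [/\ x 0 < x t2, x t1 < x 1 &
          forall s t, I s -> I t ->
            x s = x t -> z s = z t -> s = t]].

Definition zigzag (R : realType) (a : R) (lambda0 : set (R * R * R)) : Prop :=
  exists (x y z : R -> R) (t1 t2 : R),
    zigzag_param a x y z t1 t2 /\
    lambda0 = [set (x t, y t, z t) | t in `[0, 1]].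

(** [C^d.+1 x R] with points [(x, y, z, xs, ys)], where [(x, y)] is the first
    complex coordinate and [(xs, ys)] the remaining [d] ones. *)
Definition chart_space (R : realType) (d : nat) : normedModType R :=
  (R * R * R * 'rV[R]_d * 'rV[R]_d)%type.

Section ChartCoordinates.
Variables (R : realType) (d : nat).
Implicit Type q : chart_space R d.
Definition ch_q q : R * R * R := q.1.1.
Definition ch_xs q : 'rV[R]_d := q.1.2.
Definition ch_ys q : 'rV[R]_d := q.2.
End ChartCoordinates.

(** [dz - y dx - \sum_i y_i dx_i] at [q], evaluated on [w]. *)
Definition chart_form (R : realType) (d : nat) (q w : chart_space R d) : R :=
  (ch_q w).2 - (ch_q q).1.2 * (ch_q w).1.1 - dot (ch_ys q) (ch_xs w).

Definition loose_box (R : realType) (d : nat) (a b c : R)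
    : set (chart_space R d) :=
  [set q | [/\ cubeQ a (ch_q q), enorm (ch_xs q) <= b & enorm (ch_ys q) <= c]].

Definition loose_core (R : realType) (d : nat) (b : R)
    (lambda0 : set (R * R * R)) : set (chart_space R d) :=
  [set q | [/\ lambda0 (ch_q q), enorm (ch_xs q) <= b & ch_ys q = 0]].

(** Only meaningful for [1 < n]. *)
Definition loose (R : realType) (n : nat) (L : set (cspace R n)) : Prop :=
  exists (a b c : R) (lambda0 : set (R * R * R)) (U : set (cspace R n)),
    [/\ [/\ 0 < a, 0 < b & 0 < c], a < b * c, zigzag a lambda0 &
        contactomorphic (@chart_form R n.-1) (@cform R n)
          (@loose_box R n.-1 a b c) (@loose_core R n.-1 b lambda0)
          U (U `&` L)].

(** * Front spinning *)

Definition sphere (R : realType) (m : nat) : set 'rV[R]_m.+1 :=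
  [set s | enorm s = 1].

(** The first [k] coordinates and the last one of a vector of [R^k.+1]. *)
Definition vinit (R : realType) (k : nat) (v : 'rV[R]_k.+1) : 'rV[R]_k :=
  \row_i v 0 (widen_ord (leqnSn k) i).

Definition vlast (R : realType) (k : nat) (v : 'rV[R]_k.+1) : R := v 0 ord_max.

(** With [n = k.+1], the dimension [k + m.+1] is [n + m]. *)
Definition spin_front (R : realType) (k m : nat) (p : cspace R k.+1)
    (s : 'rV[R]_m.+1) : 'rV[R]_(k + m.+1) * R :=
  (row_mx (vinit p.1.1) (vlast p.1.1 *: s), p.2).

(** The Legendrian lift of [spin_front]: its [y]-coordinates are the slopes
    imposed by [dz = \sum_i y_i dx_i], see [spin_slope_forced]. *)
Definition spin_slope (R : realType) (k m : nat) (p : cspace R k.+1)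
    (s : 'rV[R]_m.+1) : 'rV[R]_(k + m.+1) :=
  row_mx (vinit p.1.2) (vlast p.1.2 *: s).

Definition front_spin (R : realType) (k m : nat) (L : set (cspace R k.+1))
    : set (cspace R (k + m.+1)) :=
  [set q | exists (p : cspace R k.+1) (s : 'rV[R]_m.+1),
     [/\ L p, sphere s, front q = spin_front p s & q.1.2 = spin_slope p s]].

(** Translation by [t] in the direction of the last [x]-coordinate. *)
Definition xtranslate (R : realType) (k : nat) (t : R) (p : cspace R k.+1)
    : cspace R k.+1 :=
  (p.1.1 + t *: delta_mx 0 ord_max, p.1.2, p.2).

Arguments front_spin {R k} m L.

Section DotTheory.
Variables (R : realType) (n : nat).
Implicit Types u v w : 'rV[R]_n.

Lemma dotC u v : dot u v = dot v u.
Proof. by apply: eq_bigr => i _; rewrite mulrC. Qed.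

Lemma dotDr u v w : dot u (v + w) = dot u v + dot u w.
Proof. by rewrite -big_split; apply: eq_bigr => i _; rewrite mxE mulrDr. Qed.

Lemma dotZr (c : R) u v : dot u (c *: v) = c * dot u v.
Proof.
by rewrite /dot mulr_sumr; apply: eq_bigr => i _; rewrite mxE mulrCA.
Qed.

Lemma dot0r u : dot u 0 = 0.
Proof. by rewrite -(scale0r 0) dotZr mul0r. Qed.

Lemma dot_delta u i : dot u (delta_mx 0 i) = u 0 i.
Proof.
rewrite /dot (bigD1 i) //= big1 => [|j ji]; last first.
  by rewrite mxE (negbTE ji) andbF mulr0.
by rewrite mxE !eqxx mulr1 addr0.
Qed.

Lemma dot_eq0 u : dot u u = 0 -> u = 0.
Proof.
move=> u0; apply/rowP => i; rewrite mxE; apply/eqP.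
rewrite -(orbb (u 0 i == 0)) -mulf_eq0; apply/eqP.
by apply: (psumr_eq0P (P := xpredT) _ u0) => // k _; exact: sqr_ge0.
Qed.

End DotTheory.

Lemma dot_row_mx (R : realType) (k l : nat) (u u' : 'rV[R]_k) (v v' : 'rV[R]_l) :
  dot (row_mx u v) (row_mx u' v') = dot u u' + dot v v'.
Proof.
rewrite /dot big_split_ord /=; congr (_ + _).
  by apply: eq_bigr => i _; rewrite !row_mxEl.
by apply: eq_bigr => i _; rewrite !row_mxEr.
Qed.

Lemma dot_vinit (R : realType) (k : nat) (u v : 'rV[R]_k.+1) :
  dot u v = dot (vinit u) (vinit v) + vlast u * vlast v.
Proof.
rewrite /dot big_ord_recr /=; congr (_ + _).
by apply: eq_bigr => i _; rewrite !mxE.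
Qed.

(** Writing [(u, h)] for the [x]- and [z]-components of a tangent vector of [L]
    at [p] and [tau] for a tangent vector of the sphere at [s], the vector
    [(row_mx (vinit u) (vlast u *: s + vlast p.1.1 *: tau), h)] is the
    corresponding tangent vector of the spun front. The slopes [spin_slope p s]
    are the only ones along which it lies in the contact structure, as soon as
    [u] ranges over [R^k.+1], that is, where the front of [L] is immersed. *)
Lemma spin_slope_forced (R : realType) (k m : nat) (p : cspace R k.+1)
    (s : 'rV[R]_m.+1) (eta : 'rV[R]_(k + m.+1)) :
  sphere s -> 0 < vlast p.1.1 ->
  (forall (u : 'rV[R]_k.+1) (h : R) (tau : 'rV[R]_m.+1), dot s tau = 0 ->
     h = dot p.1.2 u ->
     h = dot eta (row_mx (vinit u) (vlast u *: s + vlast p.1.1 *: tau))) <->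
  eta = spin_slope p s.
Proof.
move=> s1 x0.
have ss1 : dot s s = 1.
  move: s1; rewrite /sphere /enorm /= => h.
  have ss_ge0 : 0 <= dot s s by apply: sumr_ge0 => i _; exact: sqr_ge0.
  by rewrite -(sqr_sqrtr ss_ge0) h expr1n.
pose a := lsubmx eta; pose b := rsubmx eta.
have etaE : eta = row_mx a b by rewrite hsubmxK.
split=> [H|->]; last first.
  move=> u h tau st ->; rewrite dot_row_mx dot_vinit; congr (_ + _).
  by rewrite dotC dotZr dotC !dotDr !dotZr ss1 st mulr0 addr0 mulr1.
have H1 u : dot p.1.2 u = dot a (vinit u) + vlast u * dot b s.
  rewrite (H u _ 0 (dot0r s) erefl) etaE dot_row_mx scaler0 addr0.
  by rewrite dotZr.
have aE : a = vinit p.1.2.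
  apply/rowP => i; have := H1 (delta_mx 0 (widen_ord (leqnSn k) i)).
  have -> : vinit (delta_mx 0 (widen_ord (leqnSn k) i)) = delta_mx 0 i :> 'rV[R]_k.
    by apply/rowP => j; rewrite !mxE.
  rewrite dot_delta dot_delta /vlast !mxE eqxx /= => ->.
  have -> : (ord_max == widen_ord (leqnSn k) i) = false.
    by apply/negbTE; rewrite -val_eqE /= gtn_eqF.
  by rewrite mul0r addr0.
have bsE : dot b s = vlast p.1.2.
  have := H1 (delta_mx 0 ord_max).
  have -> : vinit (delta_mx 0 ord_max) = 0 :> 'rV[R]_k.
    apply/rowP => j; rewrite !mxE eqxx /=.
    by rewrite -val_eqE /= ltn_eqF.
  by rewrite dot_delta dot0r add0r /vlast mxE !eqxx mul1r => <-.
pose tau := b + (- vlast p.1.2) *: s.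
have stau : dot s tau = 0 by rewrite dotDr dotZr ss1 dotC bsE mulr1 subrr.
have btau : dot b tau = 0.
  have := H 0 0 tau stau; rewrite dot0r => /(_ erefl).
  have -> : vinit 0 = 0 :> 'rV[R]_k by apply/rowP => j; rewrite !mxE.
  rewrite /vlast mxE scale0r add0r etaE dot_row_mx dot0r add0r dotZr => /esym/eqP.
  by rewrite mulf_eq0 (gt_eqF x0) /= => /eqP.
have /dot_eq0 tau0 : dot tau tau = 0.
  by rewrite {2}/tau dotDr dotZr (dotC tau b) (dotC tau s) stau btau mulr0 addr0.
rewrite etaE /spin_slope aE; congr row_mx.
by apply/eqP; rewrite -subr_eq0 -scaleNr; apply/eqP.
Qed.

(* Main.v *)
(* The spun Legendrian is the image of [L * S^m] under [(p, s) |-> spin_pt p s],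
   which is inverted smoothly by polar coordinates where the radius [x_n] is
   positive. So it is a compact, connected, oriented submanifold, and the contact
   form restricts to it as on [L], the unit vector [s] being orthogonal to the
   tangent vectors of the sphere.

   For looseness, let [F] be a loose chart [R_abc -> U] of [L], with
   [F^* alpha = f alpha_std]. Once [U] lies in [0 < x_n], polar coordinates embed
   [U * T^* S^m] contactly, and a stereographic chart of the sphere trivializes
   [T^* S^m] over all of [R^m]. Multiplying the fibre coordinate [eta] by [f] turns
   [f alpha_std - eta dtheta] into [f (alpha_std - eta dtheta)]. Since neither
   [theta] nor [eta] is bounded, the product contains a loose chart with the same
   constants [a], [b], [c], whose core is mapped into the spun Legendrian.

   A loose chart crossing [x_n <= 0] is first pushed into [0 < x_n] by the contact
   lift of a diffeomorphism from [R] onto a subset of the positive reals that is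
   the identity near the values of [x_n] on [L]. *)

Require Import Defs.
From HB Require Import structures.
From mathcomp Require Import all_boot all_order all_algebra.
From mathcomp Require Import all_classical all_reals all_analysis.
From mathcomp Require Import ring.
Import Order.TTheory GRing.Theory Num.Theory.
Import numFieldNormedType.Exports.
Local Open Scope ring_scope.
Local Open Scope classical_set_scope.
Set Implicit Arguments.
Unset Strict Implicit.
Unset Printing Implicit Defensive.

(* The libraries' own [pmap] and [pinv] shadow those of [Defs]. *)
Local Notation pmap := Defs.pmap.
Local Notation pinv := Defs.pinv.

(** * Calculus of smooth maps *)

Section Smooth.
Variable R : realType.
Implicit Types V W X : normedModType R.

(** [contactomorphic] only compares kernels, so the factor [f] is not given: it has to be extracted
    from the chart, as the value of the pulled back form on the Reeb vector. Its sign stays unknown;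
    only [f != 0] is used. A diffeomorphism has to come with an inverse that is smooth on a
    neighbourhood of the image, and the sets involved, such as boxes, need not be open. The maps
    constructed here (polar and stereographic coordinates, the frame of covectors, the squeezing of
    a half-line) are therefore chosen with inverses in closed form, so that no inverse function
    theorem enters. The larger box lies over the smaller one with the same radii because dropping
    coordinates does not increase a Euclidean norm. The chart must meet the spun Legendrian in
    exactly the core. The delicate inclusion holds because the displacement in the cotangent fibre
    is orthogonal to [s]: polar coordinates do not see it, it can be read off from the slopes, and
    it vanishes only for [eta = 0]. *)

Lemma linear_pack V W (f : V -> W) :
  linear f -> exists g : {linear V -> W}, f = g :> (V -> W).
Proof.
move=> fl; pose F := GRing.isLinear.Build R V W _ f fl.
by pose g : {linear V -> W} := HB.pack f F; exists g.
Qed.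

Lemma continuous_at_sum V W n (F : 'I_n -> V -> W) p :
  (forall i, {for p, continuous (F i)}) ->
  {for p, continuous (fun v => \sum_i F i v)}.
Proof.
move=> cF; elim: (index_enum _) => [|i r IH].
  rewrite (_ : (fun v => _) = cst 0); first exact: cst_continuous.
  by apply/funext => v; rewrite big_nil.
rewrite (_ : (fun v => _) = (fun v => F i v + \sum_(j <- r) F j v)).
  exact: continuousD.
by apply/funext => v; rewrite big_cons.
Qed.

(* Directional derivatives of a composite are expressed in such a basis, which
   makes the chain rule an induction on the order of differentiability. *)
Class findim V : Prop := findim_coord : exists (n : nat) (e : 'I_n -> V)
  (l : 'I_n -> V -> R), [/\ forall i, continuous (l i), forall i, linear (l i) &
    forall v, v = \sum_i l i v *: e i].

Lemma linear_continuous V W {fdV : findim V} (f : V -> W) :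
  linear f -> continuous f.
Proof.
move=> /linear_pack[g ->]; have [n [e [l [lc _ lE]]]] := fdV.
rewrite (_ : (g : V -> W) = fun v => \sum_i l i v *: g (e i)).
  move=> p; apply: continuous_at_sum => i; apply: continuousZ; first exact: lc.
  exact: cst_continuous.
apply/funext => v; rewrite [in LHS](lE v) linear_sum.
by apply: eq_bigr => i _; rewrite linearZ.
Qed.

Global Instance findim_R : findim (R : normedModType R).
Proof.
exists 1%N, (fun=> 1), (fun=> id); split=> // [_ ?|v]; first exact: cvg_id.
by rewrite big_ord1; rewrite /GRing.scale /= mulr1.
Qed.

Global Instance findim_rV n : findim ('rV[R]_n : normedModType R).
Proof.
exists n, (fun i => delta_mx 0 i), (fun i (v : 'rV[R]_n) => v 0 i); split.
- move=> i; exact: coord_continuous.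
- by move=> i a u v; rewrite !mxE.
- exact: row_sum_delta.
Qed.

Global Instance findim_prod V W {fdV : findim V} {fdW : findim W} :
  findim ((V * W)%type : normedModType R).
Proof.
have [n [e [l [lc ll lE]]]] := fdV; have [m [e' [l' [lc' ll' lE']]]] := fdW.
exists (n + m)%N.
exists (fun i : 'I_(n + m) =>
  match fintype.split i with inl j => (e j, 0) | inr j => (0, e' j) end).
exists (fun (i : 'I_(n + m)) v =>
  match fintype.split i with inl j => l j v.1 | inr j => l' j v.2 end).
split.
- move=> i; case: (fintype.split i) => j p.
    apply: (@continuous_comp _ _ _ fst (l j)); last exact: lc.
    exact: cvg_fst.
  apply: (@continuous_comp _ _ _ snd (l' j)); last exact: lc'.
  exact: cvg_snd.
- by move=> i a u v; case: (fintype.split i) => j /=; rewrite ?ll ?ll'.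
move=> v; rewrite big_split_ord /=.
under eq_bigr => i _ do rewrite (unsplitK (inl i)).
under [X in _ + X]eq_bigr => i _ do rewrite (unsplitK (inr i)).
have suml (r : seq 'I_n) : \sum_(i <- r) l i v.1 *: ((e i, 0) : V * W) =
    (\sum_(i <- r) l i v.1 *: e i, 0).
  elim: r => [|i r IH]; first by rewrite !big_nil.
  by rewrite !big_cons IH; congr pair; rewrite /= scaler0 add0r.
have sumr (r : seq 'I_m) : \sum_(i <- r) l' i v.2 *: ((0, e' i) : V * W) =
    (0, \sum_(i <- r) l' i v.2 *: e' i).
  elim: r => [|i r IH]; first by rewrite !big_nil.
  by rewrite !big_cons IH; congr pair; rewrite /= scaler0 add0r.
rewrite suml sumr -lE -lE'; case: v {suml sumr} => a b; congr pair; rewrite /=.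
  by rewrite addr0.
by rewrite add0r.
Qed.

(** The first-order expansion of [f] at [p] is one of [g] as well, since little-o only sees the
    germ; uniqueness of the differential does the rest. *)
Lemma near_eq_differentiable V W (f g : V -> W) p :
  (\near p, f p = g p) -> differentiable f p ->
  differentiable g p /\ 'd g p = 'd f p :> (V -> W).
Proof.
move=> fg df; have := diff_locally df => fE.
have gE : g \o shift p = cst (g p) + 'd f p +o_0 id.
  apply/eqaddoP => e e0; have /eqaddoP /(_ e e0) := fE.
  have fgp := nbhs_singleton fg.
  have fg0 : \forall h \near (0 : V), f (h + p) = g (h + p).
    by move: fg; rewrite (near_shift 0) /= subr0.
  apply: filterS2 fg0 => h /= fgh; rewrite !fctE /= /shift /= fgh fgp.
  exact.
have dE : 'd g p = 'd f p :> (V -> W).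
  by apply: diff_unique => //; exact: diff_continuous.
split=> //; apply/diff_locallyP; rewrite dE; split=> //.
exact: diff_continuous.
Qed.

Lemma open_near V (O : set V) (P : V -> Prop) p :
  open O -> O p -> (forall q, O q -> P q) -> \forall q \near p, P q.
Proof.
move=> oO Op H; apply: filterS (open_nbhs_nbhs _); first exact: H.
by split.
Qed.

Lemma cont_diff_sub V W k (O O' : set V) (f : V -> W) :
  O' `<=` O -> cont_diff k O f -> cont_diff k O' f.
Proof.
move=> OO'; elim: k f => [|k IH] f /=; first by move=> H p /OO'; exact: H.
by move=> [d H]; split=> [p /OO'|v]; [exact: d|exact: IH].
Qed.

(** Openness of [O] makes equality on [O] pass to directional derivatives. This lets the later
    inductions replace a derivative by a formula that is valid on [O] only. *)
Lemma cont_diff_eq V W k (O : set V) (f g : V -> W) :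
  open O -> (forall p, O p -> f p = g p) -> cont_diff k O f -> cont_diff k O g.
Proof.
move=> oO; elim: k f g => [|k IH] f g fg /=.
  move=> H p Op; have := H p Op; rewrite /continuous_at => cf.
  rewrite /prop_for /continuous_at -(fg p Op); apply: cvg_trans cf; apply: near_eq_cvg.
  exact: (open_near oO Op).
move=> [d H]; split.
  by move=> p Op; have [] := near_eq_differentiable (open_near oO Op fg) (d p Op).
move=> v; apply: (IH _ _ _ (H v)) => p Op; apply: near_eq_derive.
exact: (open_near oO Op).
Qed.

Lemma cont_diffW V W k (O : set V) (f : V -> W) :
  cont_diff k.+1 O f -> cont_diff k O f.
Proof.
elim: k f => [|k IH] f [d H]; first by move=> p /d; exact: differentiable_continuous.
by split=> // v; exact: IH (H v).
Qed.

Lemma cont_diff_cst V W k (O : set V) (c : W) : cont_diff k O (fun=> c).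
Proof.
elim: k c => [|k IH] c /=; first by move=> p _; exact: cst_continuous.
split=> [p _|v]; first exact: differentiable_cst.
rewrite (_ : (fun p => _) = fun=> (0 : W)); first exact: (IH 0).
by apply/funext => p; rewrite (derive_cst c).
Qed.

Lemma linear_is_diff V W {fdV : findim V} (f : V -> W) p :
  linear f -> is_diff p f f.
Proof.
move=> fl; have fc : continuous f by exact: linear_continuous.
have [g fg] := linear_pack fl.
rewrite fg in fc *.
by apply: DiffDef; [exact: linear_differentiable fc|exact: diff_lin fc].
Qed.

Lemma cont_diff_lin V W {fdV : findim V} k (O : set V) (f : V -> W) :
  linear f -> cont_diff k O f.
Proof.
move=> fl; case: k => [|k] /=; first by move=> p _; exact: linear_continuous.
split=> [p _|v]; first by have [] : is_diff p f f by exact: linear_is_diff.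
rewrite (_ : (fun p => _) = fun=> f v); first exact: cont_diff_cst.
apply/funext => p; have [d dE] : is_diff p f f by exact: linear_is_diff.
by rewrite deriveE // dE.
Qed.

Lemma cont_diffD V W k (O : set V) (f g : V -> W) : open O ->
  cont_diff k O f -> cont_diff k O g -> cont_diff k O (fun p => f p + g p).
Proof.
move=> oO; elim: k f g => [|k IH] f g /=.
  by move=> cf cg p Op; apply: continuousD; [exact: cf|exact: cg].
move=> [df Df] [dg Dg]; split=> [p Op|v].
  exact: (differentiableD (df p Op) (dg p Op)).
apply: (cont_diff_eq oO _ (IH _ _ (Df v) (Dg v))) => p Op.
have := deriveD (@diff_derivable _ _ _ f p v (df p Op)) (@diff_derivable _ _ _ g p v (dg p Op)).
by move=> <-.
Qed.

(** The product rule is the chain rule through the continuous bilinear map [(c, w) |-> c *: w],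
    which is packed as a bilinear structure for this purpose. *)
Lemma is_diff_scale V W (a : V -> R) (f : V -> W) p :
  differentiable a p -> differentiable f p ->
  is_diff p (fun q => a q *: f q) (fun v => 'd a p v *: f p + a p *: 'd f p v).
Proof.
move=> da df; pose s (c : R) (w : W) := c *: w.
have sb : bilinear_for (GRing.Scale.Law.clone _ _ *:%R _)
    (GRing.Scale.Law.clone _ _ *:%R _) s.
  split=> [u'|u] c x y /=; rewrite /s.
    by rewrite scalerDl -scalerA.
  by rewrite scalerDr !scalerA mulrC.
pose B : {bilinear R -> W -> W} :=
  HB.pack s (bilinear_isBilinear.Build R R W W _ _ s sb).
have Bc : continuous (fun q : R * W => B q.1 q.2) by exact: scale_continuous.
have H : is_diff (a p, f p) (fun q : R * W => B q.1 q.2)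
    (fun q => B (a p) q.2 + B q.1 (f p)).
  by apply: DiffDef; [exact: differentiable_bilin Bc|exact: diff_bilin Bc].
have := is_diff_comp (is_diff_pair (differentiableP da) (differentiableP df)) H.
by move=> /is_diff_eq; apply; apply/funext => v /=; rewrite addrC.
Qed.

Lemma cont_diffZ V W k (O : set V) (a : V -> R) (f : V -> W) : open O ->
  cont_diff k O a -> cont_diff k O f -> cont_diff k O (fun p => a p *: f p).
Proof.
move=> oO; elim: k a f => [|k IH] a f.
  by move=> cf cg p Op; apply: continuousZ; [exact: cf|exact: cg].
move=> ca cf; have [da Da] := ca; have [df Df] := cf; split=> [p Op|v].
  by have [] := is_diff_scale (da p Op) (df p Op).
apply: (cont_diff_eq oO _ (cont_diffD oO (IH _ _ (Da v) (cont_diffW cf))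
  (IH _ _ (cont_diffW ca) (Df v)))) => p Op.
have [d dE] := is_diff_scale (da p Op) (df p Op).
by rewrite (deriveE _ d) dE (deriveE _ (df p Op)) (deriveE _ (da p Op)).
Qed.

Lemma cont_diff_sum V W k (O : set V) n (F : 'I_n -> V -> W) : open O ->
  (forall i, cont_diff k O (F i)) -> cont_diff k O (fun p => \sum_i F i p).
Proof.
move=> oO cF; elim: (index_enum _) => [|i r IH].
  rewrite (_ : (fun v => _) = fun=> 0); first exact: cont_diff_cst.
  by apply/funext => v; rewrite big_nil.
rewrite (_ : (fun v => _) = (fun v => F i v + \sum_(j <- r) F j v)).
  exact: cont_diffD.
by apply/funext => v; rewrite big_cons.
Qed.

Lemma cont_diff_lin_comp V W X k (O : set V) (l : W -> X) (f : V -> W) : open O ->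
  linear l -> continuous l -> cont_diff k O f -> cont_diff k O (fun p => l (f p)).
Proof.
move=> oO ll lc; elim: k f => [|k IH] f /=.
  by move=> cf p Op; apply: (@continuous_comp _ _ _ f l); [exact: cf|exact: lc].
have [g lg] := linear_pack ll; rewrite lg in lc *.
move=> [df Df]; split=> [p Op|v].
  apply: (@differentiable_comp _ _ _ _ f g); first exact: df.
  exact: linear_differentiable.
rewrite lg in IH; apply: (cont_diff_eq oO _ (IH _ (Df v))) => p Op /=.
have dg := linear_differentiable (f p) lc.
rewrite (deriveE _ (df p Op)) [RHS](deriveE _ (differentiable_comp (df p Op) dg)).
by rewrite (diff_comp (df p Op) dg) /= (diff_lin _ lc).
Qed.

Lemma cont_diff_comp V W X {fdW : findim W} k (O : set V) (O' : set W)
    (f : V -> W) (g : W -> X) :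
  open O -> open O' -> (forall p, O p -> O' (f p)) ->
  cont_diff k O f -> cont_diff k O' g -> cont_diff k O (fun p => g (f p)).
Proof.
move=> oO oO' OO'; have [n [e [l [lc ll lE]]]] := fdW.
elim: k X f g OO' => [|k IH] X f g OO'.
  by move=> cf cg p Op; apply: (@continuous_comp _ _ _ f g);
    [exact: cf|apply: cg; exact: OO'].
move=> cf cg; have [df Df] := cf; have [dg Dg] := cg; split=> [p Op|v].
  by apply: (@differentiable_comp _ _ _ _ f g); [exact: df|apply: dg; exact: OO'].
(* The derivative of [g] is taken in a direction ['d f p v] that moves with [p]. Expanding it in the
   fixed vectors [e i] leaves the functions ['D_(e i) g], to which the induction hypothesis
   applies. *)
have := @cont_diff_sum _ _ k O n
  (fun i p => l i ('D_v f p) *: 'D_(e i) g (f p)) oO.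
move=> H; apply: (cont_diff_eq oO _ (H _)).
  move=> p Op; have dfp := df p Op; have dgp := dg _ (OO' p Op).
  rewrite [RHS](deriveE _ (differentiable_comp dfp dgp)).
  rewrite (diff_comp dfp dgp) /= [in RHS](lE ('d f p v)) linear_sum.
  by apply: eq_bigr => i _; rewrite linearZ /= !deriveE.
move=> i; apply: cont_diffZ => //; first exact: (cont_diff_lin_comp oO (ll i) (lc i) (Df v)).
exact: (IH _ _ _ OO' (cont_diffW cf) (Dg (e i))).
Qed.

End Smooth.

(** * Smoothness on arbitrary subsets *)

Section SmoothOn.
Variable R : realType.
Implicit Types V W X : normedModType R.

Lemma smooth_onW V W (A B : set V) (f : V -> W) :
  B `<=` A -> smooth_on A f -> smooth_on B f.
Proof. by move=> BA [ O [oO AO fO]]; exists O; split=> //; exact: subset_trans AO. Qed.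

Lemma smooth_on_differentiable V W (A : set V) (f : V -> W) p :
  smooth_on A f -> A p -> differentiable f p.
Proof. by move=> [ O [_ AO /(_ 1%N)[df _]]] /AO; exact: df. Qed.

Lemma smooth_on_continuous V W (A : set V) (f : V -> W) p :
  smooth_on A f -> A p -> {for p, continuous f}.
Proof. by move=> [ O [_ AO /(_ 0%N) cf]] /AO; exact: cf. Qed.

Lemma smooth_on_derive V W (A : set V) (f : V -> W) v :
  smooth_on A f -> smooth_on A (fun p => 'D_v f p).
Proof.
by move=> [ O [oO AO fO]]; exists O; split=> // k; have [_] := fO k.+1; exact.
Qed.

Lemma smooth_on_cst V W (A : set V) (c : W) : smooth_on A (fun=> c).
Proof.
exists setT; split; [exact: openT|by []|by move=> k; exact: cont_diff_cst].
Qed.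

Lemma smooth_on_lin V W {fdV : findim V} (A : set V) (f : V -> W) :
  linear f -> smooth_on A f.
Proof.
move=> fl; exists setT; split; [exact: openT|by []|].
by move=> k; exact: cont_diff_lin.
Qed.

Lemma smooth_on_id V {fdV : findim V} (A : set V) : smooth_on A (id : V -> V).
Proof. by apply: smooth_on_lin. Qed.

Lemma smooth_onD V W (A : set V) (f g : V -> W) :
  smooth_on A f -> smooth_on A g -> smooth_on A (fun p => f p + g p).
Proof.
move=> [ O [oO AO fO]] [ O' [oO' AO' gO]]; exists (O `&` O'); split.
- exact: openI.
- by move=> p Ap; split; [exact: AO|exact: AO'].
move=> k; apply: cont_diffD; first exact: openI.
  by apply: (cont_diff_sub _ (fO k)) => p [].
by apply: (cont_diff_sub _ (gO k)) => p [].
Qed.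

Lemma smooth_onZ V W (A : set V) (a : V -> R) (f : V -> W) :
  smooth_on A a -> smooth_on A f -> smooth_on A (fun p => a p *: f p).
Proof.
move=> [ O [oO AO fO]] [ O' [oO' AO' gO]]; exists (O `&` O'); split.
- exact: openI.
- by move=> p Ap; split; [exact: AO|exact: AO'].
move=> k; apply: cont_diffZ; first exact: openI.
  by apply: (cont_diff_sub _ (fO k)) => p [].
by apply: (cont_diff_sub _ (gO k)) => p [].
Qed.

Lemma smooth_onM V (A : set V) (f g : V -> R) :
  smooth_on A f -> smooth_on A g -> smooth_on A (fun p => f p * g p).
Proof. exact: smooth_onZ. Qed.

(** Continuity is known on [O] only, so the preimage is cut down to [O]. This supplies the open
    neighbourhoods required of composites and of charts. *)
Lemma open_preimage_at V W (O : set V) (O' : set W) (f : V -> W) :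
  open O -> open O' -> (forall p, O p -> {for p, continuous f}) ->
  open (O `&` f @^-1` O').
Proof.
move=> oO oO' cf; rewrite openE => p [Op O'fp] /=.
apply: filterI; first exact: open_nbhs_nbhs.
by apply: (cf p Op); exact: open_nbhs_nbhs.
Qed.

Lemma smooth_on_comp V W X {fdW : findim W} (A : set V) (B : set W)
    (f : V -> W) (g : W -> X) :
  smooth_on A f -> smooth_on B g -> (forall p, A p -> B (f p)) ->
  smooth_on A (fun p => g (f p)).
Proof.
move=> [ O [oO AO fO]] [ O' [oO' BO' gO]] AB.
have oOO : open (O `&` f @^-1` O') by apply: open_preimage_at => //; exact: (fO 0%N).
exists (O `&` f @^-1` O'); split=> //.
  by move=> p Ap; split; [exact: AO|exact/BO'/AB].
move=> k; apply: (cont_diff_comp oOO oO' _ _ (gO k)); first by move=> p [].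
by apply: (cont_diff_sub _ (fO k)) => p [].
Qed.

Lemma smooth_on_lin_comp V W X {fdW : findim W} (A : set V) (f : V -> W)
    (l : W -> X) :
  linear l -> smooth_on A f -> smooth_on A (fun p => l (f p)).
Proof.
move=> ll fA; apply: (smooth_on_comp fA (B := setT)) => //.
exact: smooth_on_lin.
Qed.

Lemma smooth_onN V W {fdW : findim W} (A : set V) (f : V -> W) :
  smooth_on A f -> smooth_on A (fun p => - f p).
Proof.
apply: (smooth_on_lin_comp (l := -%R)) => a u v.
by rewrite opprD scalerN.
Qed.

Lemma smooth_onB V W {fdW : findim W} (A : set V) (f g : V -> W) :
  smooth_on A f -> smooth_on A g -> smooth_on A (fun p => f p - g p).
Proof. by move=> fA gA; apply: smooth_onD => //; exact: smooth_onN. Qed.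

Lemma smooth_on_fst V W X {fdW : findim W} {fdX : findim X} (A : set V)
    (f : V -> W * X) :
  smooth_on A f -> smooth_on A (fun p => (f p).1).
Proof. exact: smooth_on_lin_comp. Qed.

Lemma smooth_on_snd V W X {fdW : findim W} {fdX : findim X} (A : set V)
    (f : V -> W * X) :
  smooth_on A f -> smooth_on A (fun p => (f p).2).
Proof. exact: smooth_on_lin_comp. Qed.

Lemma smooth_on_pair V W X {fdW : findim W} {fdX : findim X} (A : set V)
    (f : V -> W) (g : V -> X) :
  smooth_on A f -> smooth_on A g -> smooth_on A (fun p => (f p, g p)).
Proof.
move=> fA gA.
rewrite (_ : (fun p => _) = fun p => (f p, 0) + (0, g p)); last first.
  by apply/funext => p; congr pair; rewrite /= ?addr0 ?add0r.
apply: smooth_onD.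
  apply: (smooth_on_lin_comp (l := fun w : W => (w, 0 : X))) => // a u v.
  by congr pair; rewrite /= scaler0 addr0.
apply: (smooth_on_lin_comp (l := fun w : X => (0 : W, w))) => // a u v.
by congr pair; rewrite /= scaler0 addr0.
Qed.

Lemma smooth_on_coord V n (A : set V) (f : V -> 'rV[R]_n) i :
  smooth_on A f -> smooth_on A (fun p => f p 0 i).
Proof.
apply: (smooth_on_lin_comp (l := fun w : 'rV[R]_n => w 0 i)) => a u v.
by rewrite !mxE.
Qed.

Lemma smooth_on_row_mx V n m (A : set V) (f : V -> 'rV[R]_n) (g : V -> 'rV[R]_m) :
  smooth_on A f -> smooth_on A g -> smooth_on A (fun p => row_mx (f p) (g p)).
Proof.
move=> fA gA.
apply: (smooth_on_lin_comp (f := fun p => (f p, g p))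
  (l := fun w : 'rV[R]_n * 'rV[R]_m => row_mx w.1 w.2)).
  by move=> a u v /=; rewrite scale_row_mx add_row_mx.
exact: smooth_on_pair.
Qed.

Lemma smooth_on_lsubmx V n m (A : set V) (f : V -> 'rV[R]_(n + m)) :
  smooth_on A f -> smooth_on A (fun p => lsubmx (f p)).
Proof. by apply: smooth_on_lin_comp => a u v; rewrite linearP. Qed.

Lemma smooth_on_rsubmx V n m (A : set V) (f : V -> 'rV[R]_(n + m)) :
  smooth_on A f -> smooth_on A (fun p => rsubmx (f p)).
Proof. by apply: smooth_on_lin_comp => a u v; rewrite linearP. Qed.

Lemma smooth_on_sum V W (A : set V) n (F : 'I_n -> V -> W) :
  (forall i, smooth_on A (F i)) -> smooth_on A (fun p => \sum_i F i p).
Proof.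
move=> cF; elim: (index_enum _) => [|i r IH].
  rewrite (_ : (fun v => _) = fun=> 0); first exact: smooth_on_cst.
  by apply/funext => v; rewrite big_nil.
rewrite (_ : (fun v => _) = (fun v => F i v + \sum_(j <- r) F j v)).
  exact: smooth_onD.
by apply/funext => v; rewrite big_cons.
Qed.

Lemma smooth_on_dot V n (A : set V) (f g : V -> 'rV[R]_n) :
  smooth_on A f -> smooth_on A g -> smooth_on A (fun p => dot (f p) (g p)).
Proof.
move=> fA gA; apply: smooth_on_sum => i.
by apply: smooth_onM; exact: smooth_on_coord.
Qed.

Lemma smooth_on_eq V W (A O : set V) (f g : V -> W) :
  open O -> A `<=` O -> (forall p, O p -> f p = g p) ->
  smooth_on A f -> smooth_on A g.
Proof.
move=> oO AO fg [ O' [oO' AO' fO]]; exists (O `&` O'); split.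
- exact: openI.
- by move=> p Ap; split; [exact: AO|exact: AO'].
move=> k; apply: (@cont_diff_eq _ _ _ _ _ f); first exact: openI.
  by move=> p [/fg].
by apply: (cont_diff_sub _ (fO k)) => p [].
Qed.

(** In one variable ['D_v g] is [v] times the derivative, so smoothness bootstraps from a formula
    for the derivative: an induction on [k] suffices when that formula is built from [g] itself
    (inverse, exponential) or stays in one family (flat functions). *)
Lemma cont_diff1 k (O : set R) (g g' : R -> R) : open O ->
  (forall x, O x -> is_derive x 1 g (g' x)) ->
  cont_diff k O g' -> cont_diff k.+1 O g.
Proof.
move=> oO dg cg'; have dg1 x : O x -> differentiable g x.
  by move=> /dg[d _]; exact/derivable1_diffP.
split=> // v.
apply: (cont_diff_eq oO _ (cont_diffZ oO (cont_diff_cst k O v) cg')) => x Ox.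
rewrite (deriveE _ (dg1 x Ox)) -[v in RHS]mulr1 -[v * 1]/(v *: 1) linearZ /=.
by rewrite -(deriveE _ (dg1 x Ox)); have [_ ->] := dg x Ox.
Qed.

Lemma open_neq0 : open [set x : R | x != 0].
Proof.
rewrite (_ : mkset _ = ~` [set 0]); first exact/closed_openC/closed_eq.
by apply/seteqP; split=> x /= /eqP.
Qed.

Lemma smooth_on_inv : smooth_on [set x : R | x != 0] (@GRing.inv R).
Proof.
exists [set x : R | x != 0]; split; [exact: open_neq0|by []|].
elim=> [|k IH]; first by move=> x /= x0; exact: inv_continuous.
apply: (cont_diff1 (g' := fun x => (-1) *: (x^-1 *: x^-1)) open_neq0).
  move=> x /= x0; have [] := is_deriveV x0 (is_derive_id x 1).
  move=> d dE; split=> //; rewrite dE /= scaleN1r /GRing.scale /= mulr1.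
  by rewrite -expr2 exprVn.
apply: (cont_diffZ open_neq0 (cont_diff_cst _ _ _)).
exact: (cont_diffZ open_neq0 IH IH).
Qed.

Lemma smooth_onV V (A : set V) (f : V -> R) :
  smooth_on A f -> (forall p, A p -> f p != 0) -> smooth_on A (fun p => (f p)^-1).
Proof. by move=> fA f0; apply: (smooth_on_comp fA smooth_on_inv). Qed.

Lemma smooth_on_expR : smooth_on setT (@expR R).
Proof.
exists setT; split; [exact: openT|by []|].
elim=> [|k IH]; first by move=> x _; exact: continuous_expR.
by apply: (cont_diff1 openT _ IH) => x _; exact: is_derive_expR.
Qed.

Lemma open_gt0 : open [set x : R | 0 < x].
Proof. exact: open_gt. Qed.

Lemma smooth_on_ln : smooth_on [set x : R | 0 < x] (@ln R).
Proof.
exists [set x : R | 0 < x]; split; [exact: open_gt0|by []|].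
case=> [|k]; first by move=> x /= x0; exact: continuous_ln.
have dln (x : R) : 0 < x -> is_derive x 1 (@ln R) x^-1 by exact: is_derive1_ln.
apply: (cont_diff1 open_gt0 dln).
have [ O [_ AO fO]] := smooth_on_inv.
by apply: (@cont_diff_sub _ _ _ _ O); [move=> x /= x0; apply: AO; rewrite /= gt_eqF|exact: fO].
Qed.

(** On the positive reals the root is [expR (2^-1 * ln x)], a composite of maps already known to be
    smooth. *)
Lemma smooth_on_sqrt : smooth_on [set x : R | 0 < x] (@Num.sqrt R).
Proof.
have oO := open_gt0.
apply: (smooth_on_eq oO (f := fun x => expR (2^-1 * ln x))) => //.
- move=> x /= x0; apply/esym; rewrite -[LHS](lnK (x := _)); last first.
    by rewrite posrE sqrtr_gt0.
  congr expR; apply: (@mulfI _ 2) => //; rewrite mulrA mulfV // mul1r.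
  by rewrite -[in RHS](sqr_sqrtr (ltW x0)) lnXn ?sqrtr_gt0 // mulr_natl.
apply: (smooth_on_comp _ smooth_on_expR) => //.
by apply: smooth_onM; [exact: smooth_on_cst|exact: smooth_on_ln].
Qed.

Lemma smooth_on_enorm V n (A : set V) (f : V -> 'rV[R]_n) :
  smooth_on A f -> (forall p, A p -> f p != 0) ->
  smooth_on A (fun p => enorm (f p)).
Proof.
move=> fA f0; apply: (smooth_on_comp (smooth_on_dot fA fA) smooth_on_sqrt).
move=> p Ap /=; rewrite lt_neqAle.
rewrite sumr_ge0 ?andbT => [|i _]; last exact: sqr_ge0.
by apply: contra (f0 p Ap) => /eqP/esym/dot_eq0 ->.
Qed.

End SmoothOn.

(** * A flat function *)

Section Flat.
Variable R : realType.

(* [flat P] extends [x |-> P(1/x) e^{-1/x}] by [0] to [x <= 0]. The family is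
   closed under differentiation, which makes each member smooth. *)
Definition flat (P : {poly R}) (x : R) : R :=
  if 0 < x then P.[x^-1] * expR (- x^-1) else 0.

(** A crude growth bound, to be applied at [x^-1] with [0 < x <= 1]. *)
Lemma horner_le n (P : {poly R}) (x : R) : (size P <= n.+1)%N -> 1 <= x ->
  `|P.[x]| <= (\sum_(i < n.+1) `|P`_i|) * x ^+ n.
Proof.
move=> sP x1; rewrite (horner_coef_wide _ sP) (le_trans (ler_norm_sum _ _ _))//.
rewrite mulr_suml ler_sum // => i _; rewrite normrM ler_wpM2l //.
have x0 : 0 <= x by exact: le_trans x1.
by rewrite ger0_norm ?exprn_ge0 // ler_weXn2l // -ltnS.
Qed.

Lemma flat_le (P : {poly R}) :
  exists2 C : R, 0 <= C & forall x, 0 < x <= 1 -> `|flat P x| <= C * x.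
Proof.
pose n := size P; pose S := \sum_(i < n.+1) `|P`_i|.
have S0 : 0 <= S by apply: sumr_ge0.
exists (S * n.+1`!%:R) => [|x /andP[x0 x1]]; first by rewrite mulr_ge0.
rewrite /flat x0 normrM (ger0_norm (expR_ge0 _)) expRN.
have y1 : 1 <= x^-1 by rewrite invf_ge1.
have y0 : 0 <= x^-1 by exact: le_trans y1.
(* One term of the exponential series, of degree one more than the bound [S * x^-1 ^+ n] on the
   polynomial: the quotient keeps a factor [x]. *)
have e1 : x^-1 ^+ n.+1 / n.+1`!%:R <= expR x^-1.
  by apply: le_trans (expR_ge1Dxn n y0); rewrite lerDr.
apply: le_trans (_ : S * x^-1 ^+ n * (n.+1`!%:R * x ^+ n.+1) <= _).
  apply: ler_pM; [exact: normr_ge0|by rewrite invr_ge0 expR_ge0|exact: horner_le|].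
  rewrite -[X in _ <= X]invrK lef_pV2 ?posrE ?expR_gt0 //; last first.
    by rewrite invr_gt0 mulr_gt0 ?exprn_gt0 // ltr0n fact_gt0.
  by rewrite invfM mulrC -exprVn.
rewrite -!mulrA ler_wpM2l // [X in X <= _]mulrCA ler_wpM2l // exprVn exprSr.
by rewrite mulrA mulVf ?mul1r // expf_neq0 // gt_eqF.
Qed.

(** Turns the difference quotient of [flat P] at 0 into another flat function. *)
Lemma flatX (P : {poly R}) x : x != 0 -> x^-1 * flat P x = flat ('X * P) x.
Proof.
move=> x0; rewrite /flat; case: ifPn => _; last by rewrite mulr0.
by rewrite hornerM hornerX mulrA.
Qed.

Lemma flat_derive (P : {poly R}) (x : R) :
  is_derive x 1 (flat P) (flat ('X^2 * (P - P^`())) x).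
Proof.
have [x0|x0|->] := ltgtP x 0.
- have -> : flat ('X^2 * (P - P^`())) x = 0 by rewrite /flat ltNge (ltW x0).
  apply: near_eq_is_derive (is_derive_cst (0 : R) x (1 : R)).
  near=> y; have y0 : y < 0 by near: y; exact: lt_nbhsl.
  by rewrite /flat ltNge (ltW y0).
- rewrite [X in is_derive _ _ _ X]/flat x0.
  pose g := (horner P \o (@GRing.inv R)) * ((@expR R) \o (- (@GRing.inv R : R -> R))).
  apply: (near_eq_is_derive (f := g)).
    near=> y; have y0 : 0 < y by near: y; exact: lt_nbhsr.
    by rewrite /flat y0.
  have dI : is_derive x 1 (@GRing.inv R) (- x^-1 ^+ 2).
    have := is_deriveV (lt0r_neq0 x0) (is_derive_id x 1).
    by move=> /is_derive_eq; apply; rewrite /GRing.scale /= mulr1 exprVn.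
  have := is_deriveM (is_derive1_comp (is_derive_poly P x^-1) dI)
    (@is_derive1_comp _ _ (- (@GRing.inv R : R -> R)) x _ _
       (is_derive_expR (- x^-1)) (is_deriveN dI)).
  move=> /is_derive_eq; apply.
  rewrite !hornerE /GRing.scale /= opprK; ring.
- rewrite [X in is_derive _ _ _ X]/flat ltxx.
  (* At 0 the difference quotient at [h] is [flat ('X * P) h]. It is 0 for negative [h] and at most
     [C * h] for small positive [h], so the derivative is 0. *)
  have [C C0 HC] := flat_le ('X * P).
  have H : h^-1 *: ((flat P \o shift 0) (h *: 1) - flat P 0) @[h --> 0^'] --> (0 : R).
    have C1 : 0 < C + 1 by rewrite ltr_wpDl.
    apply/cvgr0Pnorm_lt => e e0; near=> h.
    have h0 : h != 0 by near: h; exact: nbhs_dnbhs_neq.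
    rewrite /= addr0 /GRing.scale /= mulr1 [flat P 0]/flat ltxx subr0 flatX //.
    have [hp|hn] := ltP 0 h; last first.
      have -> : flat ('X * P) h = 0 by rewrite /flat ltNge hn.
      by rewrite normr0.
    (* The bound 1 is the range of [flat_le]; [C + 1] replaces [C], which may be 0. *)
    have : `|h| < Num.min 1 (e / (C + 1)).
      by near: h; apply: dnbhs0_lt; rewrite lt_min ltr01 divr_gt0.
    rewrite gtr0_norm // lt_min => /andP[h1 he].
    apply: le_lt_trans (HC h _) _; first by rewrite hp ltW.
    apply: le_lt_trans (_ : (C + 1) * h < _); last by rewrite mulrC -ltr_pdivlMr.
    by rewrite ler_wpM2r ?lerDl // ltW.
  by apply: DeriveDef; [exact: cvgP H|exact: cvg_lim H].
Unshelve. all: by end_near. Qed.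

Lemma flat_cont_diff k (P : {poly R}) : cont_diff k setT (flat P).
Proof.
elim: k P => [|k IH] P.
  move=> x _; have [d _] := flat_derive P x.
  by apply: differentiable_continuous; exact/derivable1_diffP.
apply: (@cont_diff1 R k setT (flat P) _ openT _ (IH ('X^2 * (P - P^`())))).
by move=> x _; exact: flat_derive.
Qed.

Lemma smooth_on_flat (P : {poly R}) : smooth_on setT (flat P).
Proof.
by exists setT; split; [exact: openT|by []|move=> k; exact: flat_cont_diff].
Qed.
End Flat.

(** * Differentials evaluated at a vector *)

Section Differentials.
Variable R : realType.
Implicit Types V W X : normedModType R.

Lemma diff_comp_at V W X (f : V -> W) (g : W -> X) p v :
  differentiable f p -> differentiable g (f p) ->
  'd (fun q => g (f q)) p v = 'd g (f p) ('d f p v).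
Proof. by move=> df dg; rewrite -[fun q => _]/(g \o f) (diff_comp df dg). Qed.

Lemma diff_lin_at V W {fdV : findim V} (l : V -> W) p v :
  linear l -> 'd l p v = l v.
Proof. by move=> ll; have [_ ->] : is_diff p l l by exact: linear_is_diff. Qed.

Lemma differentiable_lin V W {fdV : findim V} (l : V -> W) p :
  linear l -> differentiable l p.
Proof. by move=> ll; have [] : is_diff p l l by exact: linear_is_diff. Qed.

Lemma diff_lin_comp V W X {fdW : findim W} (f : V -> W) (l : W -> X) p v :
  linear l -> differentiable f p -> 'd (fun q => l (f q)) p v = l ('d f p v).
Proof.
move=> ll df; rewrite (diff_comp_at _ df); first by rewrite diff_lin_at.
exact: differentiable_lin.
Qed.

Lemma diff_fst V W X {fdW : findim W} {fdX : findim X} (f : V -> W * X) p v :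
  differentiable f p -> ('d f p v).1 = 'd (fun q => (f q).1) p v.
Proof. by move=> df; rewrite (diff_lin_comp _ (l := fst)). Qed.

Lemma diff_snd V W X {fdW : findim W} {fdX : findim X} (f : V -> W * X) p v :
  differentiable f p -> ('d f p v).2 = 'd (fun q => (f q).2) p v.
Proof. by move=> df; rewrite (diff_lin_comp _ (l := snd)). Qed.

Lemma diff_scale_at V W (a : V -> R) (f : V -> W) p v :
  differentiable a p -> differentiable f p ->
  'd (fun q => a q *: f q) p v = 'd a p v *: f p + a p *: 'd f p v.
Proof. by move=> da df; have [_ ->] := is_diff_scale da df. Qed.

Lemma diff_add_at V W (f g : V -> W) p v :
  differentiable f p -> differentiable g p ->
  'd (fun q => f q + g q) p v = 'd f p v + 'd g p v.
Proof. by move=> df dg; have /= := diffD df dg; rewrite -[fun q => f q + g q]/(f + g) => ->. Qed.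

Lemma diff_near V W (f g : V -> W) p v :
  (\near p, f p = g p) -> differentiable f p -> 'd g p v = 'd f p v.
Proof. by move=> fg df; have [_ ->] := near_eq_differentiable fg df. Qed.

Lemma diff_row_mx V n m (f : V -> 'rV[R]_n) (g : V -> 'rV[R]_m) p v :
  differentiable f p -> differentiable g p ->
  'd (fun q => row_mx (f q) (g q)) p v = row_mx ('d f p v) ('d g p v).
Proof.
move=> df dg.
have dfg : differentiable (fun q => (f q, g q)) p by exact: differentiable_pair.
have ll : linear (fun w : 'rV[R]_n * 'rV[R]_m => row_mx w.1 w.2).
  by move=> a u w /=; rewrite scale_row_mx add_row_mx.
by rewrite (diff_lin_comp _ ll dfg) diff_pair.
Qed.

Lemma diff_dot V n (f g : V -> 'rV[R]_n) p v :
  differentiable f p -> differentiable g p ->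
  'd (fun q => dot (f q) (g q)) p v = dot ('d f p v) (g p) + dot (f p) ('d g p v).
Proof.
move=> df dg.
have lc i : linear (fun w : 'rV[R]_n => w 0 i) by move=> a u w; rewrite !mxE.
have dc (h : V -> 'rV[R]_n) i : differentiable h p -> differentiable (fun q => h q 0 i) p.
  move=> dh; apply: (@differentiable_comp _ _ _ _ h (fun w => w 0 i)) => //.
  exact: differentiable_lin.
pose F i q := f q 0 i * g q 0 i.
have dF i : differentiable (F i) p.
  by have [] := is_diff_scale (dc f i df) (dc g i dg).
have -> : (fun q => dot (f q) (g q)) = \sum_i F i.
  by apply/funext => q; rewrite fct_sumE.
have dsum (r : seq 'I_n) : differentiable (\sum_(i <- r) F i) p /\
    'd (\sum_(i <- r) F i) p v = \sum_(i <- r) 'd (F i) p v.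
  elim: r => [|i r [d IH]].
    by rewrite !big_nil; split; [exact: differentiable_cst|rewrite (diff_cst 0)].
  rewrite !big_cons -IH; split; first exact: differentiableD.
  by rewrite diffD.
have [_ ->] := dsum (index_enum _); rewrite /dot -big_split; apply: eq_bigr => i _.
rewrite (diff_scale_at _ (dc f i df) (dc g i dg)).
by rewrite (diff_lin_comp _ (lc i) df) (diff_lin_comp _ (lc i) dg).
Qed.

End Differentials.

(** * Splitting off the last coordinate *)

Section Vjoin.
Variable R : realType.

(** The inverse of [v |-> (vinit v, vlast v)]. A [row_mx] would have length [k + 1], which is not
    convertible to [k.+1] for a variable [k]. *)
Definition vjoin (k : nat) (a : 'rV[R]_k) (b : R) : 'rV[R]_k.+1 :=
  \row_i (if insub (i : nat) is Some j then a 0 j else b).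

Lemma vinit_vjoin k (a : 'rV[R]_k) b : vinit (vjoin a b) = a.
Proof.
apply/rowP => i; rewrite !mxE /=; case: insubP => [j _ ji|].
  by congr (a 0 _); apply: val_inj.
by rewrite ltn_ord.
Qed.

Lemma vlast_vjoin k (a : 'rV[R]_k) b : vlast (vjoin a b) = b.
Proof. by rewrite /vlast mxE; case: insubP => [j|//]; rewrite ltnn. Qed.

Lemma vjoinE k (v : 'rV[R]_k.+1) : vjoin (vinit v) (vlast v) = v.
Proof.
apply/rowP => i; rewrite mxE; case: insubP => [j _ ji|]; rewrite ?mxE /=.
  by congr (v 0 _); apply: val_inj.
rewrite -leqNgt => ki; congr (v 0 _); apply: val_inj => /=.
by apply/eqP; rewrite eqn_leq ki -ltnS ltn_ord.
Qed.

Lemma vinit_lin k : linear (@vinit R k).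
Proof. by move=> a u v; apply/rowP => i; rewrite !mxE. Qed.

Lemma vlast_lin k : linear (@vlast R k).
Proof. by move=> a u v; rewrite /vlast !mxE. Qed.

Lemma vjoin_lin k : linear (fun w : 'rV[R]_k * R => vjoin w.1 w.2).
Proof. by move=> a u v; apply/rowP => i; rewrite !mxE; case: insub => [j|]; rewrite ?mxE. Qed.

Lemma dot_vjoin k (a a' : 'rV[R]_k) b b' :
  dot (vjoin a b) (vjoin a' b') = dot a a' + b * b'.
Proof. by rewrite dot_vinit !vinit_vjoin !vlast_vjoin. Qed.

Variable V : normedModType R.

Lemma smooth_on_vinit k (A : set V) (f : V -> 'rV[R]_k.+1) :
  smooth_on A f -> smooth_on A (fun p => vinit (f p)).
Proof. by apply: smooth_on_lin_comp; exact: vinit_lin. Qed.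

Lemma smooth_on_vlast k (A : set V) (f : V -> 'rV[R]_k.+1) :
  smooth_on A f -> smooth_on A (fun p => vlast (f p)).
Proof. by apply: smooth_on_lin_comp; exact: vlast_lin. Qed.

Lemma smooth_on_vjoin k (A : set V) (f : V -> 'rV[R]_k) (g : V -> R) :
  smooth_on A f -> smooth_on A g -> smooth_on A (fun p => vjoin (f p) (g p)).
Proof.
move=> fA gA; apply: (smooth_on_lin_comp (@vjoin_lin k) (smooth_on_pair fA gA)).
Qed.

Lemma diff_vjoin k (f : V -> 'rV[R]_k) (g : V -> R) p v :
  differentiable f p -> differentiable g p ->
  'd (fun q => vjoin (f q) (g q)) p v = vjoin ('d f p v) ('d g p v).
Proof.
move=> df dg.
have dfg : differentiable (fun q => (f q, g q)) p by exact: differentiable_pair.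
by rewrite (diff_lin_comp _ (@vjoin_lin k) dfg) diff_pair.
Qed.

End Vjoin.

Section Instances.
Variable R : realType.

Global Instance findim_cspace n : findim (cspace R n).
Proof. by rewrite /cspace; exact: findim_prod. Qed.

Global Instance findim_chart_space d : findim (chart_space R d).
Proof. by rewrite /chart_space; exact: findim_prod. Qed.

End Instances.

(** * Pushing into the half-space [0 < x_n] *)

Section Collar.
Variable R : realType.

(* For [v > 0] the squeezed value [w] solves [e^{1/w} = e^{1/v} + N]: hence the
   closed formulas for both directions, and [w < 1 / ln (1 + N)]. *)
Definition squeeze (N v : R) : R := v / (1 + v * ln (1 + N * flat 1 v)).

Lemma flat1_gt0 (v : R) : 0 < v -> flat 1 v = expR (- v^-1).
Proof. by move=> v0; rewrite /flat v0 hornerC mul1r. Qed.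

Lemma flat1_le0 (v : R) : v <= 0 -> flat 1 v = 0.
Proof. by move=> v0; rewrite /flat ltNge v0. Qed.

Lemma flat1_ge0 (v : R) : 0 <= flat 1 v.
Proof.
by have [v0|v0] := ltP 0 v; [rewrite flat1_gt0 // expR_ge0|rewrite flat1_le0].
Qed.

Lemma squeeze_le0 (N v : R) : v <= 0 -> squeeze N v = v.
Proof. by move=> v0; rewrite /squeeze flat1_le0 // mulr0 addr0 ln1 mulr0 addr0 divr1. Qed.

Lemma squeeze_den_gt0 (N v : R) : 0 < N -> 0 < 1 + v * ln (1 + N * flat 1 v).
Proof.
move=> N0; have [v0|v0] := ltP 0 v.
  rewrite ltr_wpDr // mulr_ge0 ?(ltW v0) // ln_ge0 // lerDl mulr_ge0 ?flat1_ge0 //.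
  exact: ltW.
by rewrite flat1_le0 // mulr0 addr0 ln1 mulr0 addr0.
Qed.

Lemma squeeze_gt0 (N v : R) : 0 < N -> 0 < v -> 0 < squeeze N v.
Proof. by move=> N0 v0; rewrite divr_gt0 ?squeeze_den_gt0. Qed.

(** The defining relation of [squeeze] after taking logarithms; both the upper bound and the inverse
    are read off from it. *)
Lemma squeezeV (N v : R) : 0 < N -> 0 < v -> (squeeze N v)^-1 = ln (expR v^-1 + N).
Proof.
move=> N0 v0; rewrite /squeeze invf_div mulrDl mul1r mulrAC divff ?gt_eqF //.
rewrite mul1r flat1_gt0 //.
have -> : expR v^-1 + N = expR v^-1 * (1 + N * expR (- v^-1)).
  by rewrite mulrDr mulr1 mulrCA -expRD subrr expR0 mulr1.
by rewrite lnM ?expRK // posrE ?expR_gt0 // ltr_wpDr // mulr_ge0 ?expR_ge0 ?ltW.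
Qed.

(** This fixes the choice of [N]: with [N = e^{1/d} - 1], the squeezed value [w] satisfies e^{1/w} =
    e^{1/v} + N > 1 + N = e^{1/d}. *)
Lemma squeeze_lt (d v : R) : 0 < d -> squeeze (expR d^-1 - 1) v < d.
Proof.
move=> d0; have N0 : 0 < expR d^-1 - 1 by rewrite subr_gt0 expR_gt1 invr_gt0.
have [v0|v0] := ltP 0 v; last by rewrite squeeze_le0 // (le_lt_trans v0).
rewrite -ltf_pV2 ?posrE ?squeeze_gt0 // squeezeV //.
rewrite -[X in X < _]expRK ltr_ln ?posrE ?expR_gt0 //; last first.
  by rewrite addr_gt0 ?expR_gt0.
by rewrite addrCA ltrDl subr_gt0 expR_gt1 invr_gt0.
Qed.

(** Solves e^{1/v} = e^{1/w} - N for [v], in the form 1/v = 1/w + ln(1 - N e^{-1/w}). The flat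
    function makes the same formula the identity for [w <= 0]. *)
Definition unsqueeze (N w : R) : R := w / (1 + w * ln (1 - N * flat 1 w)).

Definition unsqueeze_dom (N : R) : set R :=
  [set w | 0 < 1 - N * flat 1 w /\ 1 + w * ln (1 - N * flat 1 w) != 0].

Lemma squeezeK (N v : R) : 0 < N ->
  unsqueeze_dom N (squeeze N v) /\ unsqueeze N (squeeze N v) = v.
Proof.
move=> N0; have [v0|v0] := ltP 0 v; last first.
  rewrite squeeze_le0 // /unsqueeze_dom /unsqueeze /= flat1_le0 // mulr0 subr0.
  by rewrite ln1 mulr0 addr0 divr1 ltr01 oner_neq0.
set w := squeeze N v; have w0 : 0 < w by exact: squeeze_gt0.
have wE : w^-1 = ln (expR v^-1 + N) by exact: squeezeV.
have eN : 0 < expR v^-1 + N by rewrite addr_gt0 ?expR_gt0.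
have hE : 1 - N * flat 1 w = expR v^-1 / (expR v^-1 + N).
  rewrite flat1_gt0 // wE expRN lnK ?posrE //.
  apply: (@mulIf _ (expR v^-1 + N)); first by rewrite gt_eqF.
  by rewrite mulrBl mul1r -!mulrA mulVf ?gt_eqF // !mulr1 addrK.
have lE : ln (1 - N * flat 1 w) = v^-1 - w^-1.
  by rewrite hE ln_div ?posrE ?expR_gt0 // expRK wE.
have dE : 1 + w * ln (1 - N * flat 1 w) = w / v.
  by rewrite lE mulrBr divff ?gt_eqF // addrC subrK.
rewrite /unsqueeze_dom /unsqueeze /= dE hE; split; last first.
  by rewrite invf_div mulrCA divff ?mulr1 // gt_eqF.
by rewrite divr_gt0 ?expR_gt0 // mulf_neq0 ?invr_neq0 // gt_eqF.
Qed.

Lemma smooth_on_squeeze (N : R) : 0 < N -> smooth_on setT (squeeze N).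
Proof.
move=> N0; apply: smooth_onM; first exact: smooth_on_id.
apply: smooth_onV; last by move=> v _; rewrite gt_eqF ?squeeze_den_gt0.
apply: smooth_onD; first exact: smooth_on_cst.
apply: smooth_onM; first exact: smooth_on_id.
apply: (smooth_on_comp _ (smooth_on_ln R)).
  apply: smooth_onD; first exact: smooth_on_cst.
  by apply: smooth_onM; [exact: smooth_on_cst|exact: smooth_on_flat].
by move=> v _ /=; rewrite ltr_wpDr // mulr_ge0 ?flat1_ge0 ?ltW.
Qed.

Lemma smooth_on_unsqueeze (N : R) : smooth_on (unsqueeze_dom N) (unsqueeze N).
Proof.
apply: smooth_onM; first exact: smooth_on_id.
apply: smooth_onV; last by move=> v [].
apply: smooth_onD; first exact: smooth_on_cst.
apply: smooth_onM; first exact: smooth_on_id.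
apply: (smooth_on_comp _ (smooth_on_ln R)); last by move=> v [].
apply: smooth_onB; first exact: smooth_on_cst.
apply: smooth_onM; first exact: smooth_on_cst.
by apply: smooth_onW (smooth_on_flat 1).
Qed.

(** The squeezing is reflected by [v = d - (x + t)]: its identity half [v <= 0] becomes
    [d <= x + t], and its bound by [d] becomes positivity of [f]. *)
Lemma collar (d t : R) : 0 < d -> exists f g : R -> R,
  [/\ smooth_on setT f, smooth_on (range f) g, cancel f g,
      forall x, 0 < f x & forall x, d <= x + t -> f x = x + t].
Proof.
move=> d0; pose N := expR d^-1 - 1.
have N0 : 0 < N by rewrite subr_gt0 expR_gt1 invr_gt0.
exists (fun x => d - squeeze N (d - (x + t))).
exists (fun y => d - unsqueeze N (d - y) - t).
have sm A (c : R) : smooth_on A (fun x => c - x).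
  by apply: smooth_onB; [exact: smooth_on_cst|exact: smooth_on_id].
split.
- apply: (smooth_on_comp _ (sm setT d)) => //.
  apply: (smooth_on_comp _ (smooth_on_squeeze N0)) => //.
  apply: (smooth_on_comp _ (sm setT d)) => //.
  by apply: smooth_onD; [exact: smooth_on_id|exact: smooth_on_cst].
- apply: smooth_onB; last exact: smooth_on_cst.
  apply: (smooth_on_comp _ (sm setT d)) => //.
  apply: (smooth_on_comp (sm _ d) (@smooth_on_unsqueeze N)).
  move=> _ [x _ <-]; rewrite subKr.
  by have [] := squeezeK (d - (x + t)) N0.
- move=> x; rewrite subKr.
  by have [_ ->] := squeezeK (d - (x + t)) N0; rewrite subKr addrK.
- by move=> x; rewrite subr_gt0 squeeze_lt.
- by move=> x dx; rewrite squeeze_le0 ?subr_le0 // subKr.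
Qed.

End Collar.

Section ContactLift.
Variables (R : realType) (k : nat) (f g : R -> R).
Hypotheses (fS : smooth_on setT f) (gS : smooth_on (range f) g) (fK : cancel f g).
Let V : normedModType R := cspace R k.+1.

(* The lift of [x_n |-> f x_n], extended by the identity in the other variables,
   to a map preserving [cform]. *)
Definition lift_map (p : V) : V :=
  (vjoin (vinit p.1.1) (f (vlast p.1.1)),
   vjoin (vinit p.1.2) (vlast p.1.2 / 'D_1 f (vlast p.1.1)), p.2).

Definition lift_inv (q : V) : V :=
  (vjoin (vinit q.1.1) (g (vlast q.1.1)),
   vjoin (vinit q.1.2) (vlast q.1.2 * 'D_1 f (g (vlast q.1.1))), q.2).

(** Differentiating [g (f x) = x] shows that the derivative of [f] is invertible. *)
Lemma lift_derive_neq0 x : 'D_1 f x != 0.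
Proof.
have df := smooth_on_differentiable fS (I : setT x).
have dg : differentiable g (f x) by apply: (smooth_on_differentiable gS); exists x.
have H : 'd (fun y => g (f y)) x 1 = 1.
  rewrite (_ : (fun y => _) = id); last exact/funext.
  by rewrite diff_lin_at.
rewrite diff_comp_at // in H.
rewrite (deriveE _ df); apply/eqP => d0; move: H; rewrite d0 linear0.
by move/esym/eqP; rewrite oner_eq0.
Qed.

Lemma lift_mapK : cancel lift_map lift_inv.
Proof.
move=> [[x y] z]; rewrite /lift_inv /lift_map /= !vinit_vjoin !vlast_vjoin fK.
by rewrite divfK ?lift_derive_neq0 // !vjoinE.
Qed.

Lemma lift_map_smooth : smooth_on setT lift_map.
Proof.
have sx : smooth_on setT (fun p : V => vlast p.1.1).
  by apply: smooth_on_vlast; apply/smooth_on_fst/smooth_on_fst/smooth_on_id.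
apply: smooth_on_pair; last exact/smooth_on_snd/smooth_on_id.
apply: smooth_on_pair; apply: smooth_on_vjoin.
- by apply: smooth_on_vinit; apply/smooth_on_fst/smooth_on_fst/smooth_on_id.
- exact: (smooth_on_comp sx fS).
- by apply: smooth_on_vinit; apply/smooth_on_snd/smooth_on_fst/smooth_on_id.
apply: smooth_onM.
  by apply: smooth_on_vlast; apply/smooth_on_snd/smooth_on_fst/smooth_on_id.
apply: smooth_onV; last by move=> p _; exact: lift_derive_neq0.
have sd : smooth_on setT (fun x : R => 'D_1 f x) by exact: smooth_on_derive.
exact: (smooth_on_comp sx sd).
Qed.

Lemma lift_inv_smooth : smooth_on (range lift_map) lift_inv.
Proof.
apply: (@smooth_onW _ _ _ [set q : V | range f (vlast q.1.1)]).
  by move=> _ [p _ <-]; rewrite /= vlast_vjoin; exists (vlast p.1.1).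
set A := mkset _.
have sx : smooth_on A (fun p : V => vlast p.1.1).
  by apply: smooth_on_vlast; apply/smooth_on_fst/smooth_on_fst/smooth_on_id.
have sg : smooth_on A (fun p : V => g (vlast p.1.1)).
  exact: (smooth_on_comp sx gS).
apply: smooth_on_pair; last exact/smooth_on_snd/smooth_on_id.
apply: smooth_on_pair; apply: smooth_on_vjoin => //.
- by apply: smooth_on_vinit; apply/smooth_on_fst/smooth_on_fst/smooth_on_id.
- by apply: smooth_on_vinit; apply/smooth_on_snd/smooth_on_fst/smooth_on_id.
apply: smooth_onM.
  by apply: smooth_on_vlast; apply/smooth_on_snd/smooth_on_fst/smooth_on_id.
have sd : smooth_on setT (fun x : R => 'D_1 f x) by exact: smooth_on_derive.
exact: (smooth_on_comp sg sd).
Qed.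

(** The last [dx] is multiplied by the derivative of [f] and the last slope is divided by it, so
    their product, and with it the form itself, is unchanged. *)
Lemma lift_map_cform p v : cform (lift_map p) ('d lift_map p v) = cform p v.
Proof.
have dl := smooth_on_differentiable lift_map_smooth (I : setT p).
have d1 : differentiable (fun q : V => (lift_map q).1) p.
  apply: (@differentiable_comp _ _ _ _ lift_map fst) => //.
  exact: differentiable_lin.
rewrite /cform (diff_snd _ dl) (diff_fst _ dl) (diff_fst _ d1) /=.
have lxx : linear (fun q : V => q.1.1) by [].
have lx : linear (fun q : V => vlast q.1.1) by move=> a u w; rewrite -vlast_lin.
have li : linear (fun q : V => vinit q.1.1) by move=> a u w; rewrite -vinit_lin.
have lz : linear (fun q : V => q.2) by [].
have df := smooth_on_differentiable fS (I : setT (vlast p.1.1)).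
have dfx : differentiable (fun q : V => f (vlast q.1.1)) p.
  apply: (@differentiable_comp _ _ _ _ (fun q : V => vlast q.1.1) f) => //.
  exact: differentiable_lin.
rewrite (diff_lin_at _ _ lz) diff_vjoin //; last exact: differentiable_lin.
rewrite (diff_lin_at _ _ li).
have dvx : differentiable (fun q : V => vlast q.1.1) p by exact: differentiable_lin.
rewrite (diff_comp_at v dvx df) (diff_lin_at _ _ lx) dot_vjoin.
rewrite -[in X in 'd f _ X](mulr1 (vlast v.1.1)).
rewrite -[vlast v.1.1 * 1]/(vlast v.1.1 *: 1) linearZ -(deriveE _ df) /=.
rewrite [in RHS]dot_vinit; congr (_ - (_ + _)).
by rewrite /GRing.scale /= mulrCA divfK ?lift_derive_neq0 // mulrC.
Qed.

End ContactLift.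

(** * Products and diffeomorphic images of submanifolds *)

Section Manifolds.
Variable R : realType.

Lemma mul_rV_inj n m (A B : 'M[R]_(n, m)) :
  (forall v : 'rV[R]_n, v *m A = v *m B) -> A = B.
Proof. by move=> AB; apply/row_matrixP => i; rewrite !rowE. Qed.

Lemma mul_jacobian n m (f : 'rV[R]_n -> 'rV[R]_m) p v :
  differentiable f p -> v *m jacobian f p = 'd f p v.
Proof.
by move=> df; have E := deriveEjacobian v df; rewrite -E; exact: deriveE.
Qed.

Lemma jacobian_near n m (f g : 'rV[R]_n -> 'rV[R]_m) p :
  (\near p, f p = g p) -> differentiable f p -> jacobian g p = jacobian f p.
Proof.
move=> fg df; have [dg _] := near_eq_differentiable fg df.
apply: mul_rV_inj => v.
exact: etrans (mul_jacobian v dg) (etrans (diff_near v fg df) (esym (mul_jacobian v df))).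
Qed.

(** Transition maps between product charts split in this way; the block form makes their Jacobian
    determinants multiply, so product atlases of oriented atlases are oriented. *)
Lemma jacobian_row_mx n1 n2 (f : 'rV[R]_n1 -> 'rV[R]_n1)
    (g : 'rV[R]_n2 -> 'rV[R]_n2) u :
  differentiable f (lsubmx u) -> differentiable g (rsubmx u) ->
  jacobian (fun w : 'rV[R]_(n1 + n2) => row_mx (f (lsubmx w)) (g (rsubmx w))) u =
  block_mx (jacobian f (lsubmx u)) 0 0 (jacobian g (rsubmx u)).
Proof.
move=> df dg.
have ll : linear (fun w : 'rV[R]_(n1 + n2) => lsubmx w) by move=> a v w /=; rewrite linearP.
have lr : linear (fun w : 'rV[R]_(n1 + n2) => rsubmx w) by move=> a v w /=; rewrite linearP.
have dl : differentiable (fun w : 'rV[R]_(n1 + n2) => lsubmx w) u.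
  exact: differentiable_lin.
have dr : differentiable (fun w : 'rV[R]_(n1 + n2) => rsubmx w) u.
  exact: differentiable_lin.
have dfl := differentiable_comp dl df; have dgr := differentiable_comp dr dg.
have dfg : differentiable
    (fun w : 'rV[R]_(n1 + n2) => row_mx (f (lsubmx w)) (g (rsubmx w))) u.
  apply: (@differentiable_comp _ _ _ _ (fun w : 'rV[R]_(n1 + n2) =>
    (f (lsubmx w), g (rsubmx w))) (fun w => row_mx w.1 w.2)).
    exact: differentiable_pair.
  apply: differentiable_lin => a v w.
  by rewrite /= scale_row_mx add_row_mx.
apply: mul_rV_inj => v; rewrite [LHS](mul_jacobian v dfg).
rewrite (diff_row_mx _ dfl dgr).
rewrite (diff_comp_at _ dl df) (diff_comp_at _ dr dg).
rewrite (diff_lin_at _ _ ll) (diff_lin_at _ _ lr).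
rewrite -(mul_jacobian _ df) -(mul_jacobian _ dg).
by rewrite -[in RHS](hsubmxK v) mul_row_block !mulmx0 addr0 add0r.
Qed.

Section Product.
Variables (V W : normedModType R).
Context {fdV : findim V} {fdW : findim W}.

Definition prod_param d e (a : param d V) (b : param e W) :
    param (d + e) (V * W : normedModType R)%type :=
  Param [set u | pdom a (lsubmx u) /\ pdom b (rsubmx u)]
        (pimg a `*` pimg b)
        (fun u => (pmap a (lsubmx u), pmap b (rsubmx u)))
        (fun q => row_mx (pinv a q.1) (pinv b q.2)).

Lemma prod_paramP d e (L : set V) (S : set W) (a : param d V) (b : param e W) :
  is_param L a -> is_param S b -> is_param (L `*` S) (prod_param a b).
Proof.
move=> [oa oia [sa sia ima Ka]] [ob oib [sb sib imb Kb]].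
have lsub p : {for p, continuous (fun u : 'rV[R]_(d + e) => lsubmx u)}.
  by apply: linear_continuous => c u v /=; rewrite linearP.
have rsub p : {for p, continuous (fun u : 'rV[R]_(d + e) => rsubmx u)}.
  by apply: linear_continuous => c u v /=; rewrite linearP.
have sl A : smooth_on A (fun u : 'rV[R]_(d + e) => lsubmx u).
  exact/smooth_on_lsubmx/smooth_on_id.
have sr A : smooth_on A (fun u : 'rV[R]_(d + e) => rsubmx u).
  exact/smooth_on_rsubmx/smooth_on_id.
split => /=.
- have -> : [set u | pdom a (lsubmx u) /\ pdom b (rsubmx u)] =
    (setT `&` (fun u : 'rV[R]_(d + e) => lsubmx u) @^-1` pdom a) `&`
    (setT `&` (fun u : 'rV[R]_(d + e) => rsubmx u) @^-1` pdom b).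
    by rewrite !setTI.
  by apply: openI; apply: open_preimage_at => //; exact: openT.
- have -> : pimg a `*` pimg b =
    (setT `&` (@fst V W) @^-1` pimg a) `&` (setT `&` (@snd V W) @^-1` pimg b).
    by rewrite !setTI.
  by apply: openI; apply: open_preimage_at => //;
    [exact: openT|move=> p _; exact: cvg_fst|exact: openT|move=> p _; exact: cvg_snd].
split.
- apply: smooth_on_pair.
    by apply: (smooth_on_comp (sl _) sa) => u [].
  by apply: (smooth_on_comp (sr _) sb) => u [].
- apply: smooth_on_row_mx.
    apply: (smooth_on_comp _ sia); first exact/smooth_on_fst/smooth_on_id.
    by move=> q [[Lq Sq] [aq bq]].
  apply: (smooth_on_comp _ sib); first exact/smooth_on_snd/smooth_on_id.
  by move=> q [[Lq Sq] [aq bq]].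
- apply/seteqP; split=> [_ [u [au bu] <-]|[p q] [[Lp Sq] [ap bq]]] /=.
    have : (L `&` pimg a) (pmap a (lsubmx u)) by rewrite -ima; exists (lsubmx u).
    have : (S `&` pimg b) (pmap b (rsubmx u)) by rewrite -imb; exists (rsubmx u).
    by move=> [? ?] [? ?].
  have : (L `&` pimg a) p by [].
  rewrite -ima => -[u au <-].
  have : (S `&` pimg b) q by [].
  rewrite -imb => -[v bv <-].
  by exists (row_mx u v); rewrite /= row_mxKl row_mxKr.
- by move=> u [au bu]; rewrite Ka // Kb // hsubmxK.
Qed.

Lemma submanifold_prod d e (L : set V) (S : set W) :
  submanifold d L -> submanifold e S -> submanifold (d + e) (L `*` S).
Proof.
move=> mL mS [p q] [/mL[a [pa ap]] /mS[b [pb bq]]].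
by exists (prod_param a b); split=> //; exact: prod_paramP.
Qed.

Lemma transition_differentiable (U : normedModType R) d (L : set U)
    (a b : param d U) u :
  is_param L a -> is_param L b -> pdom a u -> pimg b (pmap a u) ->
  differentiable (pinv b \o pmap a) u.
Proof.
move=> [oa oia [sa sia ima Ka]] [ob oib [sb sib imb Kb]] au bu.
have : (L `&` pimg a) (pmap a u) by rewrite -ima; exists u.
move=> [Lu _]; apply: differentiable_comp.
  exact: (smooth_on_differentiable sa).
exact: (smooth_on_differentiable sib).
Qed.

Lemma orientable_prod d e (L : set V) (S : set W) :
  orientable d L -> orientable e S -> orientable (d + e) (L `*` S).
Proof.
move=> [A [pA cA dA]] [B [pB cB dB]].
exists [set c | exists a b, [/\ A a, B b & c = prod_param a b]]; split.
- by move=> _ [a [b [Aa Bb ->]]]; apply: prod_paramP; [exact: pA|exact: pB].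
- move=> [p q] [/cA[a [Aa ap]] /cB[b [Bb bq]]].
  by exists (prod_param a b); split=> //; exists a, b.
move=> _ _ u [a [b [Aa Bb ->]]] [a' [b' [Aa' Bb' ->]]] [au bu] [au' bu'] /=.
have da := transition_differentiable (pA _ Aa) (pA _ Aa') au au'.
have db := transition_differentiable (pB _ Bb) (pB _ Bb') bu bu'.
rewrite (jacobian_row_mx da db) det_ublock.
by rewrite mulr_gt0 // ?dA // dB.
Qed.

End Product.

Section Transport.
Variables (V W : normedModType R).
Context {fdV : findim V} {fdW : findim W}.
Variables (A : set V) (M : set W) (F : V -> W) (G : W -> V).
Hypothesis FG : diffeo A M F G.

Lemma diffeo_image q : M q -> exists2 p, A p & F p = q.
Proof. by have [_ _ <- _] := FG. Qed.

Lemma diffeo_mem p : A p -> M (F p).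
Proof. by have [_ _ <- _] := FG; exists p. Qed.

(** The set [O] will be an open neighbourhood of [M] on which [G] is continuous: without it the
    preimage under [G] need not be open. *)
Definition transport_param d (O : set W) (a : param d V) : param d W :=
  Param (pdom a) (O `&` G @^-1` (pimg a)) (F \o pmap a) (pinv a \o G).

Lemma transport_paramP d O (a : param d V) :
  open O -> M `<=` O -> (forall q, O q -> {for q, continuous G}) ->
  is_param A a -> is_param M (transport_param O a).
Proof.
have [sF sG imF KF] := FG => oO MO cG [oa oia [sa sia ima Ka]].
have imA u : pdom a u -> (A `&` pimg a) (pmap a u) by move=> au; rewrite -ima; exists u.
split=> //=; first exact: open_preimage_at.
split=> /=.
- by apply: (smooth_on_comp sa sF) => u /imA[].
- apply: (@smooth_on_comp _ _ _ _ _ _ (A `&` pimg a)) => //.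
    by apply: smooth_onW sG => q [].
  by move=> q [+ [_ aq]]; rewrite -imF => -[p Ap pq]; rewrite /= -pq KF // in aq; rewrite -pq KF.
- apply/seteqP; split=> [_ [u /imA[Au au] <-] /=|q [+ [Oq aq]]].
    have MFu : M (F (pmap a u)) by rewrite -imF; exists (pmap a u).
    by split=> //; split; [exact: MO|rewrite /= KF].
  rewrite -imF => -[p Ap pq]; rewrite -pq /= KF // in aq.
  have : (A `&` pimg a) p by [].
  by rewrite -ima => -[u au up]; exists u => //=; rewrite up.
- by move=> u au; rewrite /= KF ?Ka //; have [] := imA u au.
Qed.

Lemma submanifold_transport d : submanifold d A -> submanifold d M.
Proof.
have [sF [ O [oO MO cG]] imF KF] := FG => mA _ /diffeo_image[p Ap <-].
have [a [pa ap]] := mA p Ap; exists (transport_param O a); split.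
  by apply: transport_paramP => //; exact: (cG 0%N).
by split=> /=; [exact/MO/diffeo_mem|rewrite KF].
Qed.

Lemma orientable_transport d : orientable d A -> orientable d M.
Proof.
have [sF [ O [oO MO cG]] imF KF] := FG => -[P [pP cP dP]].
have tP a : P a -> is_param M (transport_param O a).
  by move=> Pa; apply: transport_paramP => //; [exact: (cG 0%N)|exact: pP].
exists [set c | exists2 a, P a & c = transport_param O a]; split.
- by move=> _ [a Pa ->]; exact: tP.
- move=> _ /diffeo_image[p Ap <-]; have [a [Pa ap]] := cP p Ap.
  exists (transport_param O a); split; first by exists a.
  by split=> /=; [exact/MO/diffeo_mem|rewrite KF].
move=> _ _ u [a Pa ->] [b Pb ->] /= au [_ /=].
have [oa oia [sa sia ima Ka]] := pP a Pa.
have imA w : pdom a w -> A (pmap a w).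
  by move=> aw; have [] : (A `&` pimg a) (pmap a w) by rewrite -ima; exists w.
rewrite (KF _ (imA _ au)) => bu.
have da := transition_differentiable (pP _ Pa) (pP _ Pb) au bu.
(* Since [G] cancels [F] on the image of a chart, the transported transition map agrees near [u]
   with the original one. *)
rewrite (jacobian_near _ da) ?dP //.
by apply: (open_near oa au) => w /imA aw; rewrite /= KF.
Qed.

End Transport.

(** Near [u] the map [f] equals [pmap c \o pinv c \o f] for a chart [c] of [L] at [f u], so the
    chain rule supplies the vector that [tangent] asks for. Tangency can then be tested with any
    differentiable map into [L], not only with charts. *)
Lemma tangent_diff (U V : normedModType R) d (L : set V)
    (f : U -> V) u h :
  submanifold d L -> differentiable f u -> (\forall w \near u, L (f w)) ->
  tangent d L (f u) ('d f u h).
Proof.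
move=> mL df Lf; have Lu := nbhs_singleton Lf.
have [c [pc cu]] := mL _ Lu; have [oc oic [sc sic imc Kc]] := pc.
have cf : (L `&` pimg c) (f u) by [].
have dp : differentiable (pinv c) (f u) by exact: (smooth_on_differentiable sic).
move: cf; rewrite -imc => -[w cw wu].
have ww : pinv c (f u) = w by rewrite -wu Kc.
have dm : differentiable (pmap c) (pinv c (f u)).
  by rewrite ww; exact: (smooth_on_differentiable sc).
exists c, w, ('d (pinv c) (f u) ('d f u h)); split=> //.
rewrite -ww -(diff_comp_at _ df dp) -(diff_comp_at _ (differentiable_comp df dp) dm).
apply: diff_near; last by apply: differentiable_comp => //; exact: differentiable_comp.
have cu' : \forall w \near u, pimg c (f w).
  by apply: (differentiable_continuous df); exact: open_nbhs_nbhs.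
apply: filterS2 Lf cu' => v Lv cv /=.
have : (L `&` pimg c) (f v) by [].
by rewrite -imc => -[x cx <-]; rewrite Kc.
Qed.

End Manifolds.

(** * The sphere *)

Section Sphere.
Variable R : realType.

(** The block matrix with rows [(1, v)] and [(u^T, 1)] factors into triangular blocks in two ways,
    by eliminating either diagonal block. *)
Lemma det_1_sub_outer n (u v : 'rV[R]_n) :
  \det (1%:M - u^T *m v) = 1 - dot v u.
Proof.
pose B : 'M[R]_(1 + n) := block_mx 1%:M v u^T 1%:M.
have B1 : B = block_mx 1%:M 0 u^T 1%:M *m block_mx 1%:M v 0 (1%:M - u^T *m v).
  by rewrite mulmx_block !mul1mx !mul0mx !mulmx1 !addr0 addrC subrK.
have B2 : B = block_mx (1%:M - v *m u^T) v 0 1%:M *m block_mx 1%:M 0 u^T 1%:M.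
  by rewrite mulmx_block !mul1mx !mul0mx !mulmx0 !mulmx1 !add0r subrK.
have : \det B = \det B by [].
rewrite {1}B1 B2 !det_mulmx !det_lblock !det_ublock !det1 !mul1r !mulr1 => ->.
rewrite det_mx11 !mxE eqxx; congr (_ - _).
by apply: eq_bigr => i _; rewrite mxE.
Qed.

Lemma dotDl n (u v w : 'rV[R]_n) : dot (u + v) w = dot u w + dot v w.
Proof. by rewrite dotC dotDr !(dotC w). Qed.

Lemma dotZl n c (u v : 'rV[R]_n) : dot (c *: u) v = c * dot u v.
Proof. by rewrite dotC dotZr dotC. Qed.

Lemma dot_ge0 n (u : 'rV[R]_n) : 0 <= dot u u.
Proof. by apply: sumr_ge0 => i _; exact: sqr_ge0. Qed.

Lemma dot_gt0 n (u : 'rV[R]_n) : u != 0 -> 0 < dot u u.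
Proof.
by move=> u0; rewrite lt_neqAle dot_ge0 andbT; apply: contra u0 => /eqP/esym/dot_eq0 ->.
Qed.

Lemma dot_scalar (a b : R) : dot (a%:M : 'rV_1) (b%:M : 'rV_1) = a * b.
Proof. by rewrite /dot big_ord1 !mxE eqxx. Qed.

Lemma enorm1P n (s : 'rV[R]_n) : enorm s = 1 <-> dot s s = 1.
Proof.
rewrite /enorm; split=> [h|->]; last exact: sqrtr1.
by rewrite -(sqr_sqrtr (dot_ge0 s)) h expr1n.
Qed.

Lemma row_mx_head m (a : R) (v : 'rV[R]_m) :
  (row_mx (a%:M : 'M[R]_1) v : 'rV[R]_m.+1) 0 0 = a.
Proof.
by rewrite mxE; case: fintype.splitP => j //= _; rewrite ord1 mxE eqxx.
Qed.

Section Stereographic.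
Variables (m : nat) (e : R).
Hypothesis e2 : e * e = 1.
Implicit Types (th : 'rV[R]_m) (s : 'rV[R]_m.+1).

(** Inverse stereographic projection from the pole with first coordinate [- e], which is where
    [1 + e * s 0 0] vanishes on the sphere. The sign [e] lets one formula serve both poles. *)
Definition stereo th : 'rV[R]_m.+1 :=
  (1 + dot th th)^-1 *: row_mx (e * (1 - dot th th))%:M (2 *: th).

Definition unstereo s : 'rV[R]_m :=
  (1 + e * s 0 0)^-1 *: (rsubmx (s : 'rV_(1 + m))).

Lemma stereo_den_gt0 th : 0 < 1 + dot th th.
Proof. by rewrite ltr_pwDl ?dot_ge0. Qed.

Lemma stereo_dot th : dot (stereo th) (stereo th) = 1.
Proof.
have d0 := lt0r_neq0 (stereo_den_gt0 th).
rewrite /stereo dotZl dotZr (@dot_row_mx _ 1 m) dot_scalar dotZl dotZr mulrACA e2.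
by rewrite mul1r; field.
Qed.

Lemma stereo0 th : stereo th 0 0 = e * (1 - dot th th) / (1 + dot th th).
Proof.
by rewrite mxE mulrC row_mx_head.
Qed.

Lemma stereo_rsub th : rsubmx (stereo th : 'rV_(1 + m)) = (1 + dot th th)^-1 *: (2 *: th).
Proof. by rewrite /stereo linearZ /= (@row_mxKr _ 1 1 m). Qed.

Lemma stereo_den th : 1 + e * stereo th 0 0 = 2 / (1 + dot th th).
Proof.
have d0 := lt0r_neq0 (stereo_den_gt0 th).
by rewrite stereo0 !mulrA e2 mul1r; field.
Qed.

Lemma stereo_den_neq0 th : 1 + e * stereo th 0 0 != 0.
Proof. by rewrite stereo_den mulf_neq0 // invr_neq0 // lt0r_neq0 // stereo_den_gt0. Qed.

Lemma stereoK : cancel stereo unstereo.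
Proof.
move=> th; rewrite /unstereo stereo_den stereo_rsub !scalerA.
have d0 := lt0r_neq0 (stereo_den_gt0 th).
by rewrite (_ : _ * _ * _ = 1) ?scale1r //; field.
Qed.

Lemma unstereoK s : dot s s = 1 -> 1 + e * s 0 0 != 0 -> stereo (unstereo s) = s.
Proof.
move=> ss d0.
have sE : s = row_mx (s 0 0)%:M (rsubmx (s : 'rV_(1 + m))) :> 'rV_(1 + m).
  rewrite -[LHS](@hsubmxK _ 1 1 m); congr row_mx; apply/rowP => i.
  rewrite !mxE ord1 eqxx mulr1n; congr (s _ _); exact: val_inj.
set s' := rsubmx (s : 'rV_(1 + m)) in sE.
(* The equation of the sphere, factored so that one factor cancels against the denominator of
   [unstereo]. *)
have s's' : dot s' s' = (1 - e * s 0 0) * (1 + e * s 0 0).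
  have -> : (1 - e * s 0 0) * (1 + e * s 0 0) = 1 - e * e * (s 0 0 * s 0 0) by ring.
  have sd : dot (s : 'rV_(1 + m)) s = s 0 0 * s 0 0 + dot s' s'.
    by rewrite {1 2}sE (@dot_row_mx _ 1 m) dot_scalar.
  by rewrite e2 mul1r -ss [dot s s]sd [RHS]addrC addKr.
have rE : dot (unstereo s) (unstereo s) = (1 - e * s 0 0) / (1 + e * s 0 0).
  by rewrite dotZl dotZr s's'; field.
rewrite /stereo rE.
have -> : 1 + (1 - e * s 0 0) / (1 + e * s 0 0) = 2 / (1 + e * s 0 0) by field.
have -> : 1 - (1 - e * s 0 0) / (1 + e * s 0 0) = 2 * (e * s 0 0) / (1 + e * s 0 0) by field.
have -> : e * (2 * (e * s 0 0) / (1 + e * s 0 0)) = 2 * s 0 0 / (1 + e * s 0 0).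
  by apply: (@etrans _ _ (e * e * (2 * s 0 0 / (1 + e * s 0 0)))); [ring|rewrite e2 mul1r].
rewrite [RHS]sE scale_row_mx /unstereo -/s' !scalerA scale_scalar_mx.
apply: (f_equal2 (@row_mx R 1 1 m)); first by congr (_%:M); field.
by rewrite (_ : _ * _ * _ = 1) ?scale1r //; field.
Qed.

Lemma smooth_on_stereo (V : normedModType R) (A : set V) (f : V -> 'rV[R]_m) :
  smooth_on A f -> smooth_on A (fun p => stereo (f p)).
Proof.
move=> fA; have sd : smooth_on A (fun p => dot (f p) (f p)) by exact: smooth_on_dot.
apply: smooth_onZ.
  apply: smooth_onV; last by move=> p _; rewrite lt0r_neq0 // stereo_den_gt0.
  by apply: smooth_onD => //; exact: smooth_on_cst.
apply: (@smooth_on_row_mx _ _ 1 m).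
  apply: (smooth_on_lin_comp (l := fun c : R => c%:M : 'rV_1)).
    by move=> a u v; rewrite scale_scalar_mx raddfD.
  apply: smooth_onM; first exact: smooth_on_cst.
  by apply: smooth_onB => //; exact: smooth_on_cst.
by apply: smooth_onZ => //; exact: smooth_on_cst.
Qed.

Lemma smooth_on_unstereo (V : normedModType R) (A : set V) (f : V -> 'rV[R]_m.+1) :
  smooth_on A f -> (forall p, A p -> 1 + e * f p 0 0 != 0) ->
  smooth_on A (fun p => unstereo (f p)).
Proof.
move=> fA f0; apply: smooth_onZ.
  apply: smooth_onV => //; apply: smooth_onD; first exact: smooth_on_cst.
  by apply: smooth_onM; [exact: smooth_on_cst|exact: smooth_on_coord].
exact: (@smooth_on_rsubmx _ _ 1 m).
Qed.

End Stereographic.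

(** The change between the two stereographic charts is inversion in the unit sphere; the first
    equation locates its domain, [th != 0]. *)
Lemma unstereo_stereoN m (e : R) (th : 'rV[R]_m) : e * e = 1 ->
  1 + (- e) * stereo e th 0 0 = 2 * dot th th / (1 + dot th th) /\
  (th != 0 -> unstereo (- e) (stereo e th) = (dot th th)^-1 *: th).
Proof.
move=> e2; have d0 := lt0r_neq0 (stereo_den_gt0 th).
have dE : 1 + (- e) * stereo e th 0 0 = 2 * dot th th / (1 + dot th th).
  by rewrite stereo0 // mulNr !mulrA e2 mul1r; field.
split=> // th0; have r0 := lt0r_neq0 (dot_gt0 th0).
rewrite /unstereo dE stereo_rsub !scalerA; congr (_ *: _); field.
by rewrite d0 r0.
Qed.

Lemma mulmx_outer n p (v u : 'rV[R]_n) (w : 'rV[R]_p) :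
  v *m (u^T *m w) = dot v u *: w.
Proof.
rewrite mulmxA [v *m u^T]mx11_scalar mul_scalar_mx; congr (_ *: _).
by rewrite !mxE; apply: eq_bigr => i _; rewrite mxE.
Qed.

Lemma smooth_on_dot_self n : smooth_on setT (fun u : 'rV[R]_n => dot u u).
Proof. by apply: smooth_on_dot; exact: smooth_on_id. Qed.

Lemma differentiable_dot_self n u : differentiable (fun u : 'rV[R]_n => dot u u) u.
Proof. exact: (smooth_on_differentiable (smooth_on_dot_self n) (I : setT u)). Qed.

Section Atlas.
Variable m : nat.

Definition flip_mx : 'M[R]_m.+1 := diag_mx (\row_i (if i == 0 then -1 else 1)).

Lemma flip_mxK : flip_mx *m flip_mx = 1%:M.
Proof.
rewrite /flip_mx mulmx_diag -diag_const_mx; congr diag_mx.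
by apply/rowP => i; rewrite !mxE; case: ifP => _; rewrite ?mulrNN mulr1.
Qed.

Lemma det_flip_mx : \det flip_mx = -1.
Proof.
rewrite det_diag (bigD1 0) //= mxE eqxx big1 ?mulr1 // => i /negbTE i0.
by rewrite mxE i0.
Qed.

Lemma dot_flip u : dot (u *m flip_mx) (u *m flip_mx) = dot u u.
Proof.
apply: eq_bigr => i _; rewrite mul_mx_diag !mxE.
by case: ifP => _; rewrite ?mulr1 // !mulrN1 mulrNN.
Qed.

(* The second stereographic chart is composed with a reflection, so that the
   orientation reversing inversion becomes an orientation preserving transition. *)
Definition sphere_turn (b : bool) : 'M[R]_m.+1 := if b then flip_mx else 1%:M.

Definition sphere_sign (b : bool) : R := if b then -1 else 1.

Definition sphere_param (b : bool) : param m.+1 ('rV[R]_m.+2 : normedModType R) :=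
  Param setT [set s : 'rV[R]_m.+2 | 1 + sphere_sign b * s 0 0 != 0]
    (fun th => stereo (sphere_sign b) (th *m sphere_turn b))
    (fun s : 'rV[R]_m.+2 => unstereo (sphere_sign b) s *m sphere_turn b).

Lemma sphere_sign2 b : sphere_sign b * sphere_sign b = 1.
Proof. by case: b; rewrite /= ?mulrNN mulr1. Qed.

Lemma sphere_turnK b : sphere_turn b *m sphere_turn b = 1%:M.
Proof. by case: b; rewrite /= ?mulmx1 // flip_mxK. Qed.

Lemma dot_turn b u : dot (u *m sphere_turn b) (u *m sphere_turn b) = dot u u.
Proof. by case: b; rewrite /= ?mulmx1 // dot_flip. Qed.

Lemma open_neq (V : normedModType R) (f : V -> R) :
  continuous f -> open [set p | f p != 0].
Proof.
move=> cf; rewrite (_ : mkset _ = setT `&` f @^-1` [set x | x != 0]).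
  apply: (@open_preimage_at R V R setT [set x | x != 0] f openT); last by move=> p _; exact: cf.
  exact: (@open_neq0 R).
by rewrite setTI.
Qed.

Lemma linear_mulmxr n p (M : 'M[R]_(n, p)) : linear (fun u : 'rV[R]_n => u *m M).
Proof. by move=> a u v; rewrite mulmxDl scalemxAl. Qed.

Lemma sphere_paramP b : is_param (@sphere R m.+1) (sphere_param b).
Proof.
have e2 := sphere_sign2 b; split => /=; first exact: openT.
  apply: open_neq => s; apply: (@smooth_on_continuous _ _ _ setT) => //.
  apply: smooth_onD; first exact: smooth_on_cst.
  apply: smooth_onM; first exact: smooth_on_cst.
  exact/smooth_on_coord/smooth_on_id.
split => /=.
- apply: smooth_on_stereo => //; apply: smooth_on_lin; exact: linear_mulmxr.
- apply: (smooth_on_lin_comp (linear_mulmxr _)).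
  by apply: smooth_on_unstereo; [exact: smooth_on_id|move=> s []].
- apply/seteqP; split=> [_ [th _ <-]|s [/enorm1P ss s0]] /=.
    by split; [apply/enorm1P; rewrite stereo_dot|exact: stereo_den_neq0].
  exists (unstereo (sphere_sign b) s *m sphere_turn b) => //=.
  by rewrite -mulmxA sphere_turnK mulmx1 unstereoK.
- by move=> th _; rewrite stereoK // -mulmxA sphere_turnK mulmx1.
Qed.

Lemma sphere_param_cover (s : 'rV[R]_m.+2) : exists b, pimg (sphere_param b) s.
Proof.
have [s0|s0] := eqVneq (1 + 1 * s 0 0) 0; last by exists false.
exists true; rewrite /= mulN1r; apply/eqP => s0'.
have : (1 + 1 * s 0 0) + (1 - s 0 0) = 0 by rewrite s0 s0' addr0.
by rewrite mul1r addrACA subrr addr0 => /eqP; rewrite -mulr2n pnatr_eq0.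
Qed.

Lemma submanifold_sphere : submanifold m.+1 (@sphere R m.+1).
Proof.
move=> s _; have [b bs] := sphere_param_cover s.
by exists (sphere_param b); split=> //; exact: sphere_paramP.
Qed.

(** The differential of inversion at [u] is [(dot u u)^-1] times the reflection in the hyperplane
    orthogonal to [u], a rank-one perturbation of the identity of determinant 1 - 2 = -1. *)
Lemma det_jacobian_inversion u (E : 'M[R]_m.+1) : u != 0 ->
  \det (jacobian (fun th : 'rV[R]_m.+1 => (dot th th)^-1 *: (th *m E)) u) =
  - (dot u u)^-1 ^+ m.+1 * \det E.
Proof.
move=> u0; have r0 := lt0r_neq0 (dot_gt0 u0); set r := dot u u in r0 *.
have dd : differentiable (fun th : 'rV[R]_m.+1 => dot th th) u.
  exact: differentiable_dot_self.
have di : differentiable (fun th : 'rV[R]_m.+1 => (dot th th)^-1) u.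
  exact: (differentiableV dd r0).
have lE := linear_mulmxr E.
have dE : differentiable (fun th : 'rV[R]_m.+1 => th *m E) u by exact: differentiable_lin.
have dF : differentiable (fun th : 'rV[R]_m.+1 => (dot th th)^-1 *: (th *m E)) u.
  by have [] := is_diff_scale di dE.
suff -> : jacobian (fun th : 'rV[R]_m.+1 => (dot th th)^-1 *: (th *m E)) u =
    r^-1 *: ((1%:M - ((2 * r^-1) *: u)^T *m u) *m E).
  rewrite detZ det_mulmx det_1_sub_outer dotZr -/r mulfVK //.
  by rewrite -[in X in 1 - X]natr1 opprD addrA subrr sub0r mulN1r mulrN mulNr.
apply: mul_rV_inj => v; rewrite [LHS](mul_jacobian v dF).
rewrite (diff_scale_at v di dE) (diff_lin_at _ _ lE).
have did : differentiable (fun th : 'rV[R]_m.+1 => th) u by exact: differentiable_lin.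
have -> : 'd (fun th : 'rV[R]_m.+1 => (dot th th)^-1) u v = - r ^- 2 * (2 * dot v u).
  rewrite (diffV dd r0) /= (diff_dot v did did) (diff_lin_at _ _ (l := fun x => x)) //.
  by rewrite [dot u v]dotC mulr_natl mulr2n.
rewrite -scalemxAr mulmxA mulmxBr mulmx1 mulmx_outer dotZr mulmxBl scalerBr.
rewrite -scalemxAl scalerA addrC; congr (_ + _); rewrite -scaleNr; congr (_ *: _).
by field.
Qed.

Lemma orientable_sphere : orientable m.+1 (@sphere R m.+1).
Proof.
exists [set c | exists b, c = sphere_param b]; split.
- by move=> _ [b ->]; exact: sphere_paramP.
- move=> s _; have [b bs] := sphere_param_cover s.
  by exists (sphere_param b); split=> //; exists b.
move=> _ _ u [b ->] [b' ->] _ /=; have e2 := sphere_sign2 b.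
have did : differentiable (fun th : 'rV[R]_m.+1 => th) u by exact: differentiable_lin.
have [<-{b'} _|] := eqVneq b b'.
  rewrite (_ : _ \o _ = fun th => th); last first.
    by apply/funext => th /=; rewrite stereoK // -mulmxA sphere_turnK mulmx1.
  suff -> : jacobian (fun th : 'rV[R]_m.+1 => th) u = 1%:M by rewrite det1.
  apply: mul_rV_inj => v; rewrite [LHS](mul_jacobian v did) mulmx1.
  by rewrite (diff_lin_at _ _ (l := fun x => x)).
move=> bb'; have sE : sphere_sign b' = - sphere_sign b.
  by case: (b) (b') bb' => [] [] //=; rewrite opprK.
(* Exactly one of two distinct charts carries the reflection, so the transition map is inversion
   followed by [flip_mx], and the two signs cancel. *)
have tE : sphere_turn b *m sphere_turn b' = flip_mx.
  by case: (b) (b') bb' => [] [] //= _; rewrite ?mulmx1 ?mul1mx.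
rewrite sE; set w := u *m sphere_turn b.
have [wE wV] := unstereo_stereoN w e2; rewrite wE => w0.
(* The origin corresponds to the pole that the other chart misses. *)
have u0 : u != 0.
  apply: contra w0 => /eqP u0; rewrite /w u0 mul0mx dot0r mulr0 mul0r.
  exact: eqxx.
pose F (th : 'rV[R]_m.+1) := (dot th th)^-1 *: (th *m flip_mx).
have FE : \near u, F u = ((fun s => unstereo (- sphere_sign b) s *m sphere_turn b') \o
    (fun th => stereo (sphere_sign b) (th *m sphere_turn b))) u.
  have oU : open [set p : 'rV[R]_m.+1 | p != 0].
    rewrite (_ : mkset _ = [set p : 'rV[R]_m.+1 | dot p p != 0]).
      by apply: open_neq => p; exact: (smooth_on_continuous (smooth_on_dot_self m.+1)).
    apply/seteqP; split=> p /=; first by move/dot_gt0/lt0r_neq0.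
    by apply: contra => /eqP ->; rewrite dot0r.
  apply: (open_near oU u0) => th /= th0.
  have [_ ->] := unstereo_stereoN (th *m sphere_turn b) e2.
    by rewrite dot_turn -scalemxAl -mulmxA tE.
  apply: contra th0 => /eqP h; rewrite -[th]mulmx1 -(sphere_turnK b) mulmxA h.
  by rewrite mul0mx.
have dF : differentiable F u.
  have dd : differentiable (fun th : 'rV[R]_m.+1 => dot th th) u.
    exact: differentiable_dot_self.
  have di : differentiable (fun th : 'rV[R]_m.+1 => (dot th th)^-1) u.
    by apply: (differentiableV dd); rewrite lt0r_neq0 // dot_gt0.
  have dE : differentiable (fun th : 'rV[R]_m.+1 => th *m flip_mx) u.
    by apply: differentiable_lin; exact: linear_mulmxr.
  by have [] := is_diff_scale di dE.
have JE := jacobian_near FE dF.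
apply: (@eq_ind_r _ _ (fun J => 0 < \det J) _ _ JE).
apply: (@eq_ind_r _ _ (fun x => 0 < x) _ _ (det_jacobian_inversion flip_mx u0)).
rewrite det_flip_mx mulrN1 opprK; apply: exprn_gt0; rewrite invr_gt0.
exact: dot_gt0.
Qed.

Lemma compact_sphere : compact (@sphere R m.+1).
Proof.
have cI (i : 'I_m.+2) : compact (`[-1, 1]%classic : set R) by exact: segment_compact.
have cc := rV_compact cI.
have clS : closed (@sphere R m.+1).
  rewrite -openC (_ : ~` _ = [set p : 'rV[R]_m.+2 | dot p p - 1 != 0]).
    apply: open_neq => p; apply: (@smooth_on_continuous _ _ _ setT) => //.
    by apply: smooth_onB; [exact: smooth_on_dot_self|exact: smooth_on_cst].
  apply/seteqP; split=> s /=; rewrite subr_eq0.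
    by move=> ns; apply/eqP => /enorm1P.
  by move=> /eqP ns /enorm1P.
apply: (subclosed_compact clS cc) => s /enorm1P ss i /=.
rewrite in_itv /= -ler_norml -(@expr_le1 _ 2) // real_normK ?num_real //.
rewrite -ss /dot (bigD1 i) //= -expr2 lerDl sumr_ge0 // => j _.
exact: sqr_ge0.
Qed.

Lemma connected_rV n : connected [set: 'rV[R]_n].
Proof.
rewrite (_ : setT = \bigcup_(v in [set: 'rV[R]_n])
  ((fun t : R => t *: v) @` `[0, 1]%classic)); last first.
  apply/seteqP; split=> // v _; exists v => //; exists 1; last by rewrite scale1r.
  by rewrite /= in_itv /= ler01 lexx.
apply: bigcup_connected.
  exists 0 => v _; exists 0; last by rewrite scale0r.
  by rewrite /= in_itv /= ler01 lexx.
move=> v _; apply: connected_continuous_connected; first exact: segment_connected.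
apply: continuous_subspaceT => t; apply: continuousZ; first exact: cvg_id.
exact: cst_continuous.
Qed.

Lemma connected_sphere : connected (@sphere R m.+1).
Proof.
have cst (e : R) : e * e = 1 -> connected (range (@stereo m.+1 e)).
  move=> e2; apply: connected_continuous_connected; first exact: connected_rV.
  apply: continuous_subspaceT => t.
  have st : smooth_on setT (fun u : 'rV[R]_m.+1 => stereo e u).
    by apply: smooth_on_stereo; exact: smooth_on_id.
  exact: (smooth_on_continuous st (I : setT t)).
rewrite (_ : @sphere R m.+1 = range (@stereo m.+1 1) `|` range (@stereo m.+1 (-1))).
  apply: connectedU; last 2 first.
  - by apply: cst; rewrite mulr1.
  - by apply: cst; rewrite mulrNN mulr1.
  (* Unit vectors are sent to the equator, where the term containing [e] vanishes and the two
     stereographic maps agree. So the two connected ranges meet. *)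
  pose d : 'rV[R]_m.+1 := delta_mx 0 0.
  have dd : dot d d = 1 by rewrite dot_delta mxE !eqxx.
  exists (stereo 1 d); split; exists d => //.
  by rewrite /stereo dd subrr !mulr0.
apply/seteqP; split=> [s ss|s [] [th _ <-]].
- have [b bs] := sphere_param_cover s; move/enorm1P in ss.
  case: b bs => /= s0; [right; exists (unstereo (-1) s)|left; exists (unstereo 1 s)] => //.
    by rewrite unstereoK // mulrNN mulr1.
  by rewrite unstereoK // mulr1.
- by apply/enorm1P; rewrite stereo_dot ?mulr1.
- by apply/enorm1P; rewrite stereo_dot ?mulrNN ?mulr1.
Qed.

End Atlas.

End Sphere.

(** The product is a union of crosses, one for each point [a] of [A], which all share the horizontal
    slice at [b0]. *)
Lemma connected_setM (V W : topologicalType) (A : set V) (B : set W) :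
  connected A -> connected B -> connected (A `*` B).
Proof.
move=> cA cB; have [->|/set0P[a0 Aa0]] := eqVneq A set0.
  rewrite set0X; exact: connected0.
have [->|/set0P[b0 Bb0]] := eqVneq B set0.
  rewrite setX0; exact: connected0.
rewrite (_ : A `*` B = \bigcup_(a in A)
    ((fun x => (x, b0)) @` A `|` (fun y => (a, y)) @` B)); last first.
  apply/seteqP; split=> [[a b] /= [Aa Bb]|[_ _] [a Aa [[x Ax [<- <-]]|[y By [<- <-]]]]] //.
  by exists a => //; right; exists b.
apply: bigcup_connected; first by exists (a0, b0) => a Aa; left; exists a0.
move=> a Aa; apply: connectedU.
- by exists (a, b0); split; [exists a|exists b0].
- apply: connected_continuous_connected => //; apply: continuous_subspaceT => x.
  by apply: cvg_pair; [exact: cvg_id|exact: cvg_cst].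
- apply: connected_continuous_connected => //; apply: continuous_subspaceT => x.
  by apply: cvg_pair; [exact: cvg_cst|exact: cvg_id].
Qed.

Lemma diff_shift_at (R : realType) (V : normedModType R) {fdV : findim V} (c p v : V) :
  'd (fun q => q + c) p v = v.
Proof.
have did : differentiable (fun q : V => q) p by exact: differentiable_lin.
have E := diff_add_at v did (differentiable_cst c p).
apply: etrans E _; rewrite (diff_lin_at _ _ (l := fun q : V => q)) //.
by rewrite (diff_cst c) addr0.
Qed.

Lemma tangent_eq (R : realType) (V : normedModType R) d (L : set V) (p p' w w' : V) :
  tangent d L p w -> p = p' -> w = w' -> tangent d L p' w'.
Proof. by move=> T <- <-. Qed.

(** * Translation of Legendrians *)

Section Translate.
Variables (R : realType) (k : nat) (t : R).
Local Notation V := (cspace R k.+1).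

Lemma xtranslateE (u : R) : @xtranslate R k u =
  fun p => p + ((u *: delta_mx 0 ord_max, 0, 0) : V).
Proof.
apply/funext => -[[x y] z]; congr (_, _, _); by rewrite /= ?addr0.
Qed.

Lemma smooth_on_xtranslate (A : set V) : smooth_on A (xtranslate t).
Proof.
by rewrite xtranslateE; apply: smooth_onD; [exact: smooth_on_id|exact: smooth_on_cst].
Qed.

Lemma xtranslateK : cancel (@xtranslate R k t) (xtranslate (- t)).
Proof.
move=> [[x y] z]; rewrite /xtranslate /=; congr (_, _, _).
by rewrite scaleNr addrK.
Qed.

Lemma diff_xtranslate (p v : V) : 'd (xtranslate t) p v = v.
Proof.
by rewrite xtranslateE; exact: diff_shift_at.
Qed.

End Translate.

Section TranslateLegendrian.
Variables (R : realType) (k : nat) (t : R) (L : set (cspace R k.+1)).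

Lemma diffeo_xtranslate : diffeo L (xtranslate t @` L) (xtranslate t) (xtranslate (- t)).
Proof.
by split=> //; [exact: smooth_on_xtranslate|exact: smooth_on_xtranslate|
  move=> p _; exact: xtranslateK].
Qed.

Lemma legendrian_xtranslate : legendrian L -> legendrian (xtranslate t @` L).
Proof.
move=> [mL cL coL oL lL]; have D := diffeo_xtranslate.
have ct : {within L, continuous (@xtranslate R k t)}.
  apply: continuous_subspaceT => p.
  exact: (smooth_on_continuous (@smooth_on_xtranslate R k t setT)).
split.
- exact: (submanifold_transport D).
- exact: continuous_compact.
- exact: connected_continuous_connected.
- exact: (orientable_transport D).
move=> _ w [p Lp <-] [c [u [h [pc cu cp ->]]]].
have [oc _ [sc _ imc _]] := pc.
have dc : differentiable (pmap c) u by exact: (smooth_on_differentiable sc).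
have dt : differentiable (@xtranslate R k (- t)) (pmap c u).
  exact: (smooth_on_differentiable (@smooth_on_xtranslate R k (- t) setT)).
have Lc : \forall v \near u, L (xtranslate (- t) (pmap c v)).
  apply: (open_near oc cu) => v cv.
  have [[q Lq <-] _] : (xtranslate t @` L `&` pimg c) (pmap c v).
    by rewrite -imc; exists v.
  by rewrite xtranslateK.
have T := tangent_diff h mL (differentiable_comp dc dt) Lc.
have E1 : xtranslate (- t) (pmap c u) = p by rewrite cp xtranslateK.
have E2 := etrans (diff_comp_at h dc dt) (diff_xtranslate (- t) _ _).
have T' := tangent_eq T E1 E2.
have lw := lL p _ Lp T'.
(* The form depends on the base point only through the slopes, which the translation leaves alone:
   the two values are convertible. *)
exact: lw.
Qed.

End TranslateLegendrian.

(** * The spun Legendrian *)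

Section Spin.
Variables (R : realType) (k m : nat).
Local Notation V := (cspace R k.+1).
Local Notation W := ('rV[R]_m.+1 : normedModType R).
Local Notation X := (cspace R (k + m.+1)).
Implicit Types (p : V) (s : W) (q : X).

Definition spin_pt p s : X :=
  (row_mx (vinit p.1.1) (vlast p.1.1 *: s),
   row_mx (vinit p.1.2) (vlast p.1.2 *: s), p.2).

Lemma front_spinP (L : set V) q :
  front_spin m L q <-> exists p s, [/\ L p, dot s s = 1 & q = spin_pt p s].
Proof.
split=> [[p [s [Lp /enorm1P ss fq yq]]]|[p [s [Lp ss ->]]]]; exists p, s.
  split=> //; case: q fq yq => [[x y] z] /= [-> ->] ->; by [].
by split=> //; exact/enorm1P.
Qed.

(** Polar coordinates in the last [m.+1] directions. The radial slope is recovered by projecting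
    onto [s], so a component of the slopes orthogonal to [s] is ignored; the same map therefore also
    serves off the spun Legendrian. *)
Definition unspin q : V * W :=
  let xt := rsubmx q.1.1 in let s := (enorm xt)^-1 *: xt in
  (vjoin (lsubmx q.1.1) (enorm xt),
   vjoin (lsubmx q.1.2) (dot (rsubmx q.1.2) s), q.2, s).

Lemma enormZ n (a : R) (s : 'rV[R]_n) : 0 <= a -> dot s s = 1 -> enorm (a *: s) = a.
Proof.
by move=> a0 ss; rewrite /enorm dotZl dotZr ss mulr1 -expr2 sqrtr_sqr ger0_norm.
Qed.

Lemma unspinK p s : 0 < vlast p.1.1 -> dot s s = 1 -> unspin (spin_pt p s) = (p, s).
Proof.
move=> p0 ss; rewrite /unspin /spin_pt /= !row_mxKl !row_mxKr enormZ ?(ltW p0) //.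
rewrite scalerA mulVf ?gt_eqF // scale1r dotZl ss mulr1 !vjoinE.
by case: p p0 => [[x y] z].
Qed.

Lemma spin_pt_tail_neq0 p s : 0 < vlast p.1.1 -> dot s s = 1 ->
  rsubmx (spin_pt p s).1.1 != 0.
Proof.
move=> p0 ss; rewrite /= row_mxKr scaler_eq0 gt_eqF //=.
by apply/eqP => s0; move: ss; rewrite s0 dot0r => /esym/eqP; rewrite oner_eq0.
Qed.

Lemma smooth_on_spin_pt (U : normedModType R) (A : set U) (f : U -> V) (g : U -> W) :
  smooth_on A f -> smooth_on A g -> smooth_on A (fun u => spin_pt (f u) (g u)).
Proof.
move=> fA gA.
have f1 : smooth_on A (fun u => (f u).1) by exact: smooth_on_fst.
have f11 : smooth_on A (fun u => (f u).1.1) by exact: smooth_on_fst.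
have f12 : smooth_on A (fun u => (f u).1.2) by exact: smooth_on_snd.
apply: smooth_on_pair; last exact: smooth_on_snd.
apply: smooth_on_pair; apply: smooth_on_row_mx.
- exact: smooth_on_vinit.
- by apply: smooth_onZ => //; exact: smooth_on_vlast.
- exact: smooth_on_vinit.
- by apply: smooth_onZ => //; exact: smooth_on_vlast.
Qed.

Lemma smooth_on_unspin : smooth_on [set q : X | rsubmx q.1.1 != 0] unspin.
Proof.
set A := mkset _; have id0 : smooth_on A (fun q : X => q) by exact: smooth_on_id.
have id1 : smooth_on A (fun q : X => q.1) by exact: smooth_on_fst.
have id11 : smooth_on A (fun q : X => q.1.1) by exact: smooth_on_fst.
have id12 : smooth_on A (fun q : X => q.1.2) by exact: smooth_on_snd.
have rx : smooth_on A (fun q : X => rsubmx q.1.1) by exact: smooth_on_rsubmx.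
have en : smooth_on A (fun q : X => enorm (rsubmx q.1.1)) by exact: smooth_on_enorm.
have ss : smooth_on A (fun q : X => (enorm (rsubmx q.1.1))^-1 *: rsubmx q.1.1).
  apply: smooth_onZ => //; apply: smooth_onV => // q q0.
  by rewrite /enorm sqrtr_eq0 -ltNge dot_gt0.
apply: smooth_on_pair => //.
apply: smooth_on_pair; last exact: smooth_on_snd.
apply: smooth_on_pair; apply: smooth_on_vjoin => //.
- exact: smooth_on_lsubmx.
- exact: smooth_on_lsubmx.
- by apply: smooth_on_dot => //; exact: smooth_on_rsubmx.
Qed.

Lemma diffeo_spin (L : set V) : (forall p, L p -> 0 < vlast p.1.1) ->
  diffeo (L `*` @sphere R m) (front_spin m L)
    (fun ps : V * W => spin_pt ps.1 ps.2) unspin.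
Proof.
move=> L0; split.
- by apply: smooth_on_spin_pt; [apply: smooth_on_fst|apply: smooth_on_snd];
    exact: smooth_on_id.
- apply: smooth_onW smooth_on_unspin => _ /front_spinP[p [s [Lp ss ->]]].
  exact: spin_pt_tail_neq0 (L0 p Lp) ss.
- apply/seteqP; split=> [_ [[p s] [/= Lp /enorm1P ss] <-]|_ /front_spinP[p [s [Lp ss ->]]]].
    by apply/front_spinP; exists p, s.
  by exists (p, s) => //; split=> //; exact/enorm1P.
- by move=> [p s] [/= Lp /enorm1P ss]; rewrite unspinK //; exact: L0.
Qed.

Lemma diff_spin_row (U : normedModType R) (F : U -> 'rV[R]_k.+1) (g : U -> W) u h :
  differentiable F u -> differentiable g u ->
  differentiable (fun v => row_mx (vinit (F v)) (vlast (F v) *: g v)) u /\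
  'd (fun v => row_mx (vinit (F v)) (vlast (F v) *: g v)) u h =
    row_mx (vinit ('d F u h)) (vlast ('d F u h) *: g u + vlast (F u) *: 'd g u h).
Proof.
move=> dF dg.
have dvi : differentiable (fun v => vinit (F v)) u.
  apply: (@differentiable_comp _ _ _ _ F (@vinit R k)) => //.
  by apply: differentiable_lin; exact: vinit_lin.
have dvl : differentiable (fun v => vlast (F v)) u.
  apply: (@differentiable_comp _ _ _ _ F (@vlast R k)) => //.
  by apply: differentiable_lin; exact: vlast_lin.
have [dsc _] := is_diff_scale dvl dg.
split.
  apply: (@differentiable_comp _ _ _ _
    (fun v => (vinit (F v), vlast (F v) *: g v)) (fun w => row_mx w.1 w.2)).
    exact: differentiable_pair.
  by apply: differentiable_lin => a v w; rewrite /= scale_row_mx add_row_mx.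
apply: etrans (diff_row_mx h dvi dsc) _.
apply: (f_equal2 (fun x y => row_mx x y)).
  exact: (diff_lin_comp h (@vinit_lin R k) dF).
apply: etrans (diff_scale_at h dvl dg) _; apply: (f_equal (+%R ^~ _)).
exact: (f_equal ( *:%R ^~ (g u)) (diff_lin_comp h (@vlast_lin R k) dF)).
Qed.

Lemma differentiable_fst (U Y Z : normedModType R) {fdY : findim Y} {fdZ : findim Z}
    (F : U -> Y * Z) u :
  differentiable F u -> differentiable (fun v => (F v).1) u.
Proof.
move=> dF; apply: (@differentiable_comp _ _ _ _ F fst) => //.
exact: differentiable_lin.
Qed.

Lemma differentiable_snd (U Y Z : normedModType R) {fdY : findim Y} {fdZ : findim Z}
    (F : U -> Y * Z) u :
  differentiable F u -> differentiable (fun v => (F v).2) u.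
Proof.
move=> dF; apply: (@differentiable_comp _ _ _ _ F snd) => //.
exact: differentiable_lin.
Qed.

(** The contact form sees only the [x]- and [z]-components of a tangent vector, hence only these are
    computed. *)
Lemma diff_spin_pt (U : normedModType R) (f : U -> V) (g : U -> W) u h :
  differentiable f u -> differentiable g u ->
  [/\ differentiable (fun v => spin_pt (f v) (g v)) u,
      ('d (fun v => spin_pt (f v) (g v)) u h).1.1 =
        row_mx (vinit ('d f u h).1.1)
          (vlast ('d f u h).1.1 *: g u + vlast (f u).1.1 *: 'd g u h) &
      ('d (fun v => spin_pt (f v) (g v)) u h).2 = ('d f u h).2].
Proof.
move=> df dg.
have df1 : differentiable (fun v => (f v).1) u by exact: differentiable_fst.
have df2 : differentiable (fun v => (f v).2) u by exact: differentiable_snd.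
have df11 : differentiable (fun v => (f v).1.1) u by exact: differentiable_fst.
have df12 : differentiable (fun v => (f v).1.2) u by exact: differentiable_snd.
have [dx dxE] := diff_spin_row h df11 dg; have [dy _] := diff_spin_row h df12 dg.
have d1 : differentiable (fun v => (spin_pt (f v) (g v)).1) u.
  exact: differentiable_pair.
have dS : differentiable (fun v => spin_pt (f v) (g v)) u.
  exact: differentiable_pair.
have fE : 'd (fun v => (f v).1.1) u h = ('d f u h).1.1.
  by rewrite (diff_fst _ df) (diff_fst _ df1).
split=> //; last by rewrite (diff_snd _ dS) /= (diff_snd _ df).
rewrite (diff_fst _ dS) (diff_fst _ d1) -fE; exact: dxE.
Qed.

(** With [w] in the role of a tangent vector of the sphere, [dot s s = 1] reduces the radial pairing
    to the one on [L], and [dot s w = 0] removes the angular term. *)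
Lemma cform_spin p s (v : V) (w : W) (dq : X) : dot s s = 1 -> dot s w = 0 ->
  dq.1.1 = row_mx (vinit v.1.1) (vlast v.1.1 *: s + vlast p.1.1 *: w) ->
  dq.2 = v.2 -> cform (spin_pt p s) dq = cform p v.
Proof.
move=> ss sw E1 E2; rewrite /cform E1 E2 /= dot_row_mx [in RHS]dot_vinit.
by rewrite dotZl dotDr !dotZr ss sw mulr0 addr0 mulr1.
Qed.

Lemma dot_diff_unit (U : normedModType R) (g : U -> W) u h :
  differentiable g u -> (\forall v \near u, dot (g v) (g v) = 1) ->
  dot (g u) ('d g u h) = 0.
Proof.
move=> dg g1; have E := diff_dot h dg dg.
have E0 : 'd (fun v => dot (g v) (g v)) u h = 0.
  have g1' : \near u, (fun=> 1) u = dot (g u) (g u) by apply: filterS g1 => v ->.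
  have d1 : differentiable (fun=> 1 : R) u by exact: differentiable_cst.
  apply: etrans (diff_near h g1' d1) _.
  have -> : 'd (fun=> 1 : R) u = 0 :> (U -> R) by exact: (diff_cst (1 : R)).
  by [].
move: E; rewrite E0 dotC -mulr2n => /esym/eqP; rewrite mulrn_eq0 /= => /eqP; exact.
Qed.

Lemma legendrian_spin (L : set V) : (1 <= m)%N -> legendrian L ->
  (forall p, L p -> 0 < vlast p.1.1) -> legendrian (front_spin m L).
Proof.
move=> m1 [mL cL coL oL lL] L0; have D := diffeo_spin L0.
have [mS oS cS coS] : [/\ submanifold m (@sphere R m), orientable m (@sphere R m),
    compact (@sphere R m) & connected (@sphere R m)].
  (* For [m = 0] the sphere is a pair of points and not connected; the sphere lemmas concern
     dimension at least 1. *)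
  case: (m) m1 => // m' _; split.
  - exact: submanifold_sphere.
  - exact: orientable_sphere.
  - exact: compact_sphere.
  - exact: connected_sphere.
have cont : {within L `*` @sphere R m,
    continuous (fun ps : V * W => spin_pt ps.1 ps.2)}.
  apply: continuous_subspaceT => ps.
  have : smooth_on setT (fun ps : V * W => spin_pt ps.1 ps.2).
    by apply: smooth_on_spin_pt; [apply: smooth_on_fst|apply: smooth_on_snd];
      exact: smooth_on_id.
  by move=> sm; exact: (smooth_on_continuous sm).
(* The product has dimension [k.+1 + m] whereas [legendrian] asks for [k + m.+1]. These are equal
   but not convertible, so the dimension is made a variable. *)
have dE d : d = (k.+1 + m)%N ->
    submanifold d (front_spin m L) /\ orientable d (front_spin m L).
  move=> ->; split.
    exact: (submanifold_transport D (submanifold_prod mL mS)).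
  exact: (orientable_transport D (orientable_prod oL oS)).
have [mM oM] := dE _ (esym (addSnnS k m)).
have [_ _ imD _] := D.
split=> //.
- by rewrite -imD; apply: continuous_compact => //; exact: compact_setX.
- by rewrite -imD; apply: connected_continuous_connected => //; exact: connected_setM.
move=> q w Lq [c [u [h [pc cu cq ->]]]].
have [oc _ [sc _ imc _]] := pc.
have Mc v : pdom c v -> exists p s, [/\ L p, dot s s = 1 & pmap c v = spin_pt p s].
  move=> cv; apply/front_spinP.
  by have [] : (front_spin m L `&` pimg c) (pmap c v) by rewrite -imc; exists v.
(* A chart of the spun Legendrian need not be a product. Composed with [unspin] it still splits into
   a family in [L] and one on the sphere, which separates the two parts of a tangent vector. *)
pose f v := (unspin (pmap c v)).1; pose g v := (unspin (pmap c v)).2.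
have fgE v : pdom c v ->
    [/\ L (f v), dot (g v) (g v) = 1 & spin_pt (f v) (g v) = pmap c v].
  move=> /Mc[p [s [Lp ss E]]]; rewrite /f /g E unspinK //; exact: L0.
have sfg : smooth_on (pdom c) (fun v => unspin (pmap c v)).
  apply: (smooth_on_comp sc smooth_on_unspin) => v /Mc[p [s [Lp ss ->]]].
  exact: spin_pt_tail_neq0 (L0 p Lp) ss.
have df : differentiable f u.
  by apply: (smooth_on_differentiable (smooth_on_fst sfg)).
have dg : differentiable g u.
  by apply: (smooth_on_differentiable (smooth_on_snd sfg)).
have [dS E1 E2] := diff_spin_pt h df dg.
have [Lf gg SE] := fgE u cu.
have near_c : \near u, spin_pt (f u) (g u) = pmap c u.
  by apply: (open_near oc cu) => v /fgE[].
rewrite (diff_near h near_c dS) -cq -SE.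
rewrite (cform_spin gg _ E1 E2); last first.
  by apply: dot_diff_unit => //; apply: (open_near oc cu) => v /fgE[].
apply: lL => //; apply: tangent_diff => //.
by apply: (open_near oc cu) => v /fgE[].
Qed.

End Spin.

(** * Loose charts *)

Section ContactComp.
Variable R : realType.

Lemma diffeo_comp (V W X : normedModType R) {fdV : findim V} {fdW : findim W}
    (A : set V) (B : set W) (C : set X) F G H K :
  diffeo A B F G -> diffeo B C H K -> diffeo A C (H \o F) (G \o K).
Proof.
move=> [sF sG imF KF] [sH sK imH KH]; split.
- by apply: (smooth_on_comp sF sH) => p Ap; rewrite -imF; exists p.
- apply: (smooth_on_comp sK sG) => q; rewrite -imH => -[p Bp <-].
  by rewrite KH.
- by rewrite -image_comp imF.
- by move=> p Ap /=; rewrite KH ?KF // -imF; exists p.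
Qed.

Lemma contactomorphism_comp (V W X : normedModType R) {fdV : findim V} {fdW : findim W}
    (al : V -> V -> R) (be : W -> W -> R) (ga : X -> X -> R)
    (A A0 : set V) (B B0 : set W) (C : set X) F G H K :
  contactomorphism al be A A0 B B0 F G -> diffeo B C H K ->
  (forall p v, B p -> (be p v = 0 <-> ga (H p) ('d H p v) = 0)) ->
  contactomorphism al ga A A0 C (H @` B0) (H \o F) (G \o K).
Proof.
move=> [DF imF0 cF] DH cH; have [sF _ imF _] := DF; have [sH _ _ _] := DH.
split; [exact: diffeo_comp DH|by rewrite -image_comp imF0|move=> p v Ap].
have BF : B (F p) by rewrite -imF; exists p.
have dF := smooth_on_differentiable sF Ap.
have dH := smooth_on_differentiable sH BF.
have E : 'd (H \o F) p v = 'd H (F p) ('d F p v) := diff_comp_at v dF dH.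
apply: iff_trans (cF p v Ap) _; apply: iff_trans (cH _ _ BF) _.
by apply: (@eq_ind_r _ _ (fun w => _ <-> ga _ w = 0) _ _ E).
Qed.

End ContactComp.

(** * Moving a loose chart into the half-space *)

Section PushPositive.
Variables (R : realType) (k : nat) (t : R) (L : set (cspace R k.+1)).
Local Notation V := (cspace R k.+1).

Lemma vlast_delta (u : R) (x : 'rV[R]_k.+1) :
  vlast (x + u *: delta_mx 0 ord_max) = vlast x + u.
Proof. by rewrite /vlast !mxE !eqxx mulr1. Qed.

Lemma xtranslate_vjoin (p : V) :
  xtranslate t p = (vjoin (vinit p.1.1) (vlast p.1.1 + t), p.1.2, p.2).
Proof.
congr (_, _, _); rewrite -vlast_delta -[LHS]vjoinE; congr vjoin.
apply/rowP => i; rewrite !mxE [_ == ord_max](_ : _ = false) ?andbF ?mulr0 ?addr0 //.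
by apply/negbTE; rewrite -val_eqE /= ltn_eqF.
Qed.

Lemma compact_lower_bound : compact L ->
  (forall p, L p -> 0 < vlast p.1.1 + t) ->
  exists2 d, 0 < d & forall p, L p -> d < vlast p.1.1 + t.
Proof.
move=> cL L0; have [LE|/set0P Lne] := eqVneq L set0.
  by exists 1; rewrite ?ltr01 // => p; rewrite LE.
have sm : smooth_on setT (fun p : V => vlast p.1.1 + t).
  apply: smooth_onD; last exact: smooth_on_cst.
  by apply: smooth_on_vlast; apply/smooth_on_fst/smooth_on_fst/smooth_on_id.
have cf : {within L, continuous (fun p : V => vlast p.1.1 + t)}.
  apply: continuous_subspaceT => p; exact: (smooth_on_continuous sm (I : setT p)).
have [p Lp pmin] := compact_EVT_min Lne cL cf.
have p0 : 0 < vlast p.1.1 + t by apply: L0; rewrite inE in Lp.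
(* Half of the minimum, because the inequality has to be strict: the collar must be the translation
   on a neighbourhood of the values on [L], not just at them. *)
exists ((vlast p.1.1 + t) / 2); first by rewrite divr_gt0.
move=> q Lq; apply: lt_le_trans (pmin q _); last by rewrite inE.
by rewrite ltr_pdivrMr // ltr_pMr // ltr1n.
Qed.

(* Only the Legendrian, not the loose chart, is known to lie in [0 < x_n]: the
   chart is moved by a contactomorphism of the whole space into that half-space
   which agrees with the translation near the Legendrian. *)
Lemma push_chart (Z : normedModType R) {fdZ : findim Z} (al : Z -> Z -> R)
    (A A0 : set Z) (U : set V) :
  contactomorphic al (@cform R k.+1) A A0 U (U `&` L) -> compact L ->
  (forall p, L p -> 0 < vlast p.1.1 + t) ->
  exists2 U' : set V, (forall p, U' p -> 0 < vlast p.1.1) &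
    contactomorphic al (@cform R k.+1) A A0 U' (U' `&` xtranslate t @` L).
Proof.
move=> [F [G FG]] cL L0; have [d d0 Ld] := compact_lower_bound cL L0.
have [f [g [fS gS fK fgt0 fE]]] := collar t d0.
(* [lift_map] divides the last slope by this derivative; the value 1 makes it agree with the
   translation on [L] in the slopes too. *)
have fd x : d < x + t -> 'D_1 f x = 1.
  move=> dx; have fN : \forall y \near x, y + t = f y.
    have oN : open [set y : R | d < y + t].
      rewrite (_ : mkset _ = [set y | d - t < y]); first exact: open_gt.
      by apply/seteqP; split=> y /=; rewrite ltrBlDr.
    by apply: (open_near oN dx) => y /= dy; rewrite fE // ltW.
  have did : differentiable (fun y : R => y + t) x.
    apply: (@differentiableD _ _ _ (fun y : R => y) (fun=> t)).
      exact: differentiable_lin.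
    exact: differentiable_cst.
  by rewrite -(near_eq_derive (1 : R) fN) deriveE //; exact: diff_shift_at.
pose H := lift_map f : V -> V.
have HE p : L p -> H p = xtranslate t p.
  move=> /Ld dp; rewrite xtranslate_vjoin /H /lift_map fE ?ltW // fd // divr1.
  by rewrite vjoinE.
(* As [H] is injective on the whole space and moves [L] as the translation does, no point of [U] off
   [L] can land on the translated Legendrian. *)
have HU : H @` U `&` xtranslate t @` L = H @` (U `&` L).
  apply/seteqP; split=> [_ [[p Up <-] [p' Lp' ptp]]|_ [p [Up Lp] <-]].
    exists p => //; split=> //.
    by rewrite -(lift_mapK fS gS fK p) -[lift_map f p]ptp -HE // lift_mapK.
  by split; [exists p|exists p => //; rewrite HE].
exists (H @` U); first by move=> _ [p Up <-]; rewrite /= vlast_vjoin.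
rewrite HU; exists (H \o F), (G \o lift_inv f g).
apply: contactomorphism_comp FG _ _.
- split=> //.
  + by apply: smooth_onW (lift_map_smooth k fS gS fK).
  + apply: smooth_onW (lift_inv_smooth k fS gS) => _ [p _ <-]; by exists p.
  + by move=> p _; exact: lift_mapK.
- move=> p v _; split=> [<-|E]; first exact: (lift_map_cform fS gS fK).
  by apply: etrans E; apply/esym; exact: (lift_map_cform fS gS fK).
Qed.

End PushPositive.

(** * The cotangent bundle of the sphere in a stereographic chart *)

Section Fibre.
Variables (R : realType) (m : nat).
Implicit Types th et w : 'rV[R]_m.

(* The covector [et] at [th], pushed to the tangent space of the sphere by the
   inverse transpose of the derivative of the stereographic chart. *)
Definition cotangent th et : 'rV[R]_m.+1 :=
  row_mx (- dot th et)%:M (((1 + dot th th) / 2) *: et - dot th et *: th).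

(** The first entry of [cotangent th et] is [- dot th et], so it cancels the multiple of [th] in the
    remaining entries and leaves a multiple of [et]. *)
Definition uncotangent th (v : 'rV[R]_m.+1) : 'rV[R]_m :=
  (2 / (1 + dot th th)) *: (rsubmx (v : 'rV_(1 + m)) - v 0 0 *: th).

Lemma cotangentK th et : uncotangent th (cotangent th et) = et.
Proof.
have d0 := lt0r_neq0 (stereo_den_gt0 th).
rewrite /uncotangent /cotangent row_mx_head (@row_mxKr _ 1 1 m) scaleNr opprK subrK.
by rewrite scalerA (_ : _ * _ = 1) ?scale1r //; field.
Qed.

Lemma uncotangent0 th : uncotangent th 0 = 0.
Proof. by rewrite /uncotangent mxE scale0r subr0 linear0 scaler0. Qed.

Lemma dotNr n (u v : 'rV[R]_n) : dot u (- v) = - dot u v.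
Proof. by rewrite -scaleN1r dotZr mulN1r. Qed.

(** The second vector is [stereo 1 th] up to the positive factor [1 + dot th th]. So
    [cotangent th et] is tangent to the sphere, and the derivative of that factor drops out of
    pairings with it. *)
Lemma dot_cotangent_head th et :
  dot (cotangent th et) (row_mx (1 - dot th th)%:M (2 *: th) : 'rV_(1 + m)) = 0.
Proof.
rewrite /cotangent (@dot_row_mx _ 1 m) dot_scalar dotZr [dot (_ + _) _]dotC dotDr dotNr !dotZr.
by field.
Qed.

Lemma dot_stereo_cotangent th et : dot (stereo 1 th) (cotangent th et) = 0.
Proof. by rewrite /stereo mul1r dotZl dotC dot_cotangent_head mulr0. Qed.

Lemma smooth_on_stereo1 : smooth_on setT (fun th => stereo (1 : R) th).
Proof. by apply: smooth_on_stereo; exact: smooth_on_id. Qed.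

(** The canonical form of the cotangent bundle of the sphere becomes [dot et] of dtheta. The
    stereographic map is written [a *: B]: the term with the differential of [a] vanishes by
    [dot_cotangent_head], and the other one is explicit. *)
Lemma dot_cotangent_diff th et w :
  dot (cotangent th et) ('d (fun u : 'rV[R]_m => stereo (1 : R) u) th w) = dot et w.
Proof.
pose a (u : 'rV[R]_m) := (1 + dot u u)^-1.
pose B (u : 'rV[R]_m) : 'rV[R]_m.+1 := row_mx (1 - dot u u)%:M (2 *: u).
have su : smooth_on setT (fun u : 'rV[R]_m => u) by exact: smooth_on_id.
have sd := @smooth_on_dot_self R m.
have sc : smooth_on setT (fun u : 'rV[R]_m => 1 - dot u u).
  by apply: smooth_onB => //; exact: smooth_on_cst.
have s2 : smooth_on setT (fun u : 'rV[R]_m => 2 *: u).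
  by apply: smooth_onZ => //; exact: smooth_on_cst.
have lM : linear (fun c : R => c%:M : 'rV_1).
  by move=> x u v; rewrite scale_scalar_mx raddfD.
have sM : smooth_on setT (fun u : 'rV[R]_m => (1 - dot u u)%:M : 'rV_1).
  exact: (smooth_on_lin_comp lM sc).
have da : differentiable a th.
  suff sa : smooth_on setT a by exact: (smooth_on_differentiable sa (I : setT th)).
  apply: smooth_onV; last by move=> u _; rewrite lt0r_neq0 // stereo_den_gt0.
  by apply: smooth_onD => //; exact: smooth_on_cst.
have dM := smooth_on_differentiable sM (I : setT th).
have d2 := smooth_on_differentiable s2 (I : setT th).
have dc := smooth_on_differentiable sc (I : setT th).
have dd := differentiable_dot_self th.
have du := smooth_on_differentiable su (I : setT th).
have dB : differentiable B th.
  have sB : smooth_on setT B by exact: (@smooth_on_row_mx _ _ 1 m).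
  exact: (smooth_on_differentiable sB (I : setT th)).
have dB1 : 'd B th w = row_mx (- (2 * dot th w))%:M (2 *: w) :> 'rV_(1 + m).
  apply: etrans (@diff_row_mx R _ 1 m _ _ th w dM d2) _.
  apply: (f_equal2 (@row_mx R 1 1 m)).
    apply: etrans (diff_lin_comp w lM dc) _; congr (_%:M).
    have lN : linear (-%R : R -> R) by move=> x u v; rewrite opprD scalerN.
    have dN : differentiable (fun u : 'rV[R]_m => - dot u u) th.
      by apply: (differentiable_comp dd); exact: differentiable_lin.
    have d1 : differentiable (fun _ : 'rV[R]_m => 1 : R) th by exact: differentiable_cst.
    have E1 := diff_add_at w d1 dN.
    have E2 : 'd (fun _ : 'rV[R]_m => 1 : R) th w = 0.
      by have -> : 'd (fun=> 1 : R) th = 0 :> ('rV[R]_m -> R) by exact: (diff_cst (1 : R)).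
    have E3 : 'd (fun u : 'rV[R]_m => - dot u u) th w =
        - 'd (fun u : 'rV[R]_m => dot u u) th w by exact: (diff_lin_comp w lN dd).
    have E4 := diff_dot w du du.
    have E5 : 'd (fun u : 'rV[R]_m => u) th w = w by exact: diff_lin_at.
    apply: etrans E1 _; rewrite E2 add0r; apply: etrans E3 _; congr (- _).
    by apply: etrans E4 _; rewrite E5 dotC -mulr2n mulr_natl.
  apply: etrans (diff_lin_at th w (l := fun u : 'rV[R]_m => 2 *: u) _) _ => //.
  by move=> c u v; rewrite scalerDr !scalerA mulrC.
have sE : (fun u : 'rV[R]_m => stereo (1 : R) u) = fun u => a u *: B u.
  by apply/funext => u; rewrite /stereo mul1r.
rewrite sE.
have E := diff_scale_at w da dB.
apply: (@eq_ind_r _ _ (fun x => dot _ x = _) _ _ E).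
rewrite dotDr !dotZr dot_cotangent_head mulr0 add0r.
apply: (@eq_ind_r _ _ (fun x => _ * dot _ x = _) _ _ dB1).
have d0 := lt0r_neq0 (stereo_den_gt0 th).
rewrite /cotangent (@dot_row_mx _ 1 m) dot_scalar dotZr [dot (_ + _) _]dotC dotDr dotNr !dotZr.
rewrite /a [dot w et]dotC [dot w th]dotC; field.
exact: d0.
Qed.

End Fibre.

Section Norms.
Variable R : realType.

(** This puts the box of the spun chart over that of the given one with unchanged radii, so that
    [a < b * c] is inherited. *)
Lemma enorm_lsubmx n1 n2 (u : 'rV[R]_(n1 + n2)) :
  enorm (lsubmx u) <= enorm u.
Proof.
rewrite /enorm ler_wsqrtr // -[in X in _ <= X](hsubmxK u) dot_row_mx lerDl.
exact: dot_ge0.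
Qed.

End Norms.

(** * The chart spun from a given chart *)

Section SpunChart.
Variables (R : realType) (k m : nat).
Local Notation Z1 := (chart_space R k).
Local Notation Z2 := (chart_space R (k + m)).
Local Notation V := (cspace R k.+1).
Local Notation W := ('rV[R]_m.+1 : normedModType R).
Local Notation X := (cspace R (k + m.+1)).
Variables (A : set Z1) (U : set V) (F : Z1 -> V) (G : V -> Z1).
Hypothesis DF : diffeo A U F G.
Hypothesis cF : forall q v, A q -> (chart_form q v = 0 <-> cform (F q) ('d F q v) = 0).
Hypothesis U0 : forall p, U p -> 0 < vlast p.1.1.

(** The Reeb vector of [chart_form]. *)
Definition chart_dz : Z1 := (0, 0, 1, 0, 0).

Lemma chart_form_sub (q v : Z1) c :
  chart_form q (v - c *: chart_dz) = chart_form q v - c.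
Proof.
have e1 : (ch_q (v - c *: chart_dz)).2 = (ch_q v).2 - c.
  by rewrite -[RHS]/(_ - _) -[in RHS](mulr1 c).
have e2 : (ch_q (v - c *: chart_dz)).1.1 = (ch_q v).1.1.
  by apply: etrans (_ : (ch_q v).1.1 - c * 0 = _) => //; rewrite mulr0 subr0.
have e3 : ch_xs (v - c *: chart_dz) = ch_xs v.
  by apply: etrans (_ : ch_xs v - c *: 0 = _) => //; rewrite scaler0 subr0.
by rewrite /chart_form e1 e2 e3; ring.
Qed.

Lemma chart_form_dz (q : Z1) : chart_form q chart_dz = 1.
Proof.
by rewrite /chart_form /ch_q /ch_xs /= mulr0 dot0r !subr0.
Qed.

Lemma cform_sub (p v w : V) (c : R) :
  cform p (v - c *: w) = cform p v - c * cform p w.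
Proof.
rewrite /cform /= dotDr dotNr dotZr; rewrite -[c *: w.2]/(c * w.2); ring.
Qed.

(** At boundary points of the box the derivative is that of the smooth extension of [F], so the
    factor is smooth up to the boundary. *)
Definition conformal_factor (q : Z1) : R := cform (F q) ('D_chart_dz F q).

Lemma chart_differentiable q : A q -> differentiable F q.
Proof. by move=> Aq; have [sF _ _ _] := DF; exact: (smooth_on_differentiable sF). Qed.

(** The vector [v - chart_form q v *: chart_dz] lies in the kernel of [chart_form], hence its image
    lies in the kernel of [cform]; the claim follows by linearity. *)
Lemma cform_chart q v : A q ->
  cform (F q) ('d F q v) = conformal_factor q * chart_form q v.
Proof.
move=> Aq; have dF := chart_differentiable Aq.
have [+ _] := cF (v - chart_form q v *: chart_dz) Aq.
rewrite chart_form_sub subrr => /(_ erefl).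
rewrite linearB linearZ cform_sub => /eqP; rewrite subr_eq0 => /eqP ->.
by rewrite /conformal_factor (deriveE _ dF) mulrC.
Qed.

Lemma conformal_factor_neq0 q : A q -> conformal_factor q != 0.
Proof.
move=> Aq; apply/eqP => f0; have [_] := cF chart_dz Aq.
rewrite cform_chart // f0 mul0r => /(_ erefl); rewrite chart_form_dz => /eqP.
by rewrite oner_eq0.
Qed.

Lemma smooth_on_conformal_factor : smooth_on A conformal_factor.
Proof.
have [sF _ _ _] := DF; have sD := smooth_on_derive chart_dz sF.
have s1 : smooth_on A (fun q => (F q).1) by exact: smooth_on_fst.
have s2 : smooth_on A (fun q => ('D_chart_dz F q).1) by exact: smooth_on_fst.
apply: smooth_onB; first exact: smooth_on_snd.
by apply: smooth_on_dot; [exact: smooth_on_snd|exact: smooth_on_fst].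
Qed.

(** The omitted coordinates [rsubmx Q.1.2] and [rsubmx Q.2] are the stereographic coordinate theta
    of the sphere and its fibre coordinate eta. *)
Definition chart_base (Q : Z2) : Z1 := (Q.1.1, lsubmx Q.1.2, lsubmx Q.2).

(* The contact form of the chart pulls back to [conformal_factor] times the
   standard one, hence the rescaling of the fibre coordinate of the cotangent
   bundle of the sphere. *)
Definition fibre_shift (Q : Z2) : W :=
  (conformal_factor (chart_base Q) / vlast (F (chart_base Q)).1.1) *:
    cotangent (rsubmx Q.1.2) (rsubmx Q.2).

(** The spun point with its slopes moved off the spun Legendrian, orthogonally to the sphere point.
    The radius divided out in [fibre_shift] is the factor that the tangent vectors of the sphere
    acquire in the spun front. *)
Definition spun_map (Q : Z2) : X :=
  let P := spin_pt (F (chart_base Q)) (stereo 1 (rsubmx Q.1.2)) in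
  (P.1.1, P.1.2 + row_mx 0 (fibre_shift Q), P.2).

Definition spun_inv (q : X) : Z2 :=
  let ps := unspin q in
  let q1 := G ps.1 in
  let th := unstereo 1 ps.2 in
  let ze := rsubmx q.1.2 - vlast ps.1.1.2 *: ps.2 in
  let et := uncotangent th ((vlast ps.1.1.1 / conformal_factor q1) *: ze) in
  (q1.1.1, row_mx q1.1.2 th, row_mx q1.2 et).

(** The radial slope is an inner product with [s], to which [z] contributes nothing; so the
    displacement can be recovered after the base point and the sphere point. *)
Lemma unspin_shift (p : V) (s z : W) : 0 < vlast p.1.1 -> dot s s = 1 ->
  dot s z = 0 ->
  unspin ((spin_pt p s).1.1, (spin_pt p s).1.2 + row_mx 0 z, (spin_pt p s).2) = (p, s).
Proof.
move=> p0 ss sz; rewrite -[RHS](unspinK p0 ss) /unspin /= !row_mxKl !row_mxKr.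
rewrite add_row_mx addr0 !row_mxKl !row_mxKr enormZ ?(ltW p0) //.
by rewrite !scalerA mulVf ?gt_eqF // scale1r dotDl [dot z s]dotC sz addr0.
Qed.

Variable B : set Z2.
Hypothesis BA : forall Q, B Q -> A (chart_base Q).

Lemma chart_pos q : A q -> 0 < vlast (F q).1.1.
Proof. by move=> Aq; apply: U0; have [_ _ <- _] := DF; exists q. Qed.

Lemma stereo1_dot th : dot (stereo 1 th : W) (stereo 1 th) = 1.
Proof. by rewrite stereo_dot // mulr1. Qed.

Lemma dot_fibre_shift Q : dot (stereo 1 (rsubmx Q.1.2)) (fibre_shift Q) = 0.
Proof. by rewrite dotZr dot_stereo_cotangent mulr0. Qed.

Lemma unspin_spun_map Q : B Q ->
  unspin (spun_map Q) = (F (chart_base Q), stereo 1 (rsubmx Q.1.2)).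
Proof.
move=> /BA AQ; apply: unspin_shift; [exact: chart_pos|exact: stereo1_dot|].
exact: dot_fibre_shift.
Qed.

Lemma spun_map_tail Q : B Q -> rsubmx (spun_map Q).1.1 != 0.
Proof. by move=> /BA AQ; apply: spin_pt_tail_neq0; [exact: chart_pos|exact: stereo1_dot]. Qed.

Lemma spun_mapK Q : B Q -> spun_inv (spun_map Q) = Q.
Proof.
move=> BQ; have AQ := BA BQ; have [_ _ _ KF] := DF.
rewrite /spun_inv unspin_spun_map //= KF // stereoK ?mulr1 //.
rewrite add_row_mx !row_mxKr addrC addKr.
rewrite /fibre_shift scalerA (_ : _ * _ = 1).
  by rewrite scale1r cotangentK !hsubmxK; case: Q {BQ AQ} => [[q x] y].
rewrite mulrA divfK ?divff //; first by rewrite lt0r_neq0 // chart_pos.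
exact: conformal_factor_neq0.
Qed.

Lemma smooth_on_spun_map : smooth_on B spun_map.
Proof.
have id0 : smooth_on B (fun Q : Z2 => Q) by exact: smooth_on_id.
have id1 : smooth_on B (fun Q : Z2 => Q.1) by exact: smooth_on_fst.
have id2 : smooth_on B (fun Q : Z2 => Q.2) by exact: smooth_on_snd.
have id12 : smooth_on B (fun Q : Z2 => Q.1.2) by exact: smooth_on_snd.
have sb : smooth_on B chart_base.
  apply: smooth_on_pair; last exact: smooth_on_lsubmx.
  by apply: smooth_on_pair; [exact: smooth_on_fst|exact: smooth_on_lsubmx].
have sth : smooth_on B (fun Q : Z2 => rsubmx Q.1.2) by exact: smooth_on_rsubmx.
have set_ : smooth_on B (fun Q : Z2 => rsubmx Q.2) by exact: smooth_on_rsubmx.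
have [sF _ _ _] := DF.
have sFb : smooth_on B (fun Q => F (chart_base Q)) by exact: (smooth_on_comp sb sF).
have sP : smooth_on B (fun Q => spin_pt (F (chart_base Q)) (stereo 1 (rsubmx Q.1.2))).
  by apply: smooth_on_spin_pt => //; exact: smooth_on_stereo.
have sP1 : smooth_on B (fun Q => (spin_pt (F (chart_base Q)) (stereo 1 (rsubmx Q.1.2))).1).
  exact: smooth_on_fst.
have sF1 : smooth_on B (fun Q => (F (chart_base Q)).1) by exact: smooth_on_fst.
have sF11 : smooth_on B (fun Q => (F (chart_base Q)).1.1) by exact: smooth_on_fst.
have sdd : smooth_on B (fun Q : Z2 => dot (rsubmx Q.1.2) (rsubmx Q.1.2)).
  exact: smooth_on_dot.
have sde : smooth_on B (fun Q : Z2 => dot (rsubmx Q.1.2) (rsubmx Q.2)).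
  exact: smooth_on_dot.
apply: smooth_on_pair; last exact: smooth_on_snd.
apply: smooth_on_pair; first exact: smooth_on_fst.
apply: smooth_onD; first exact: smooth_on_snd.
apply: smooth_on_row_mx; first exact: smooth_on_cst.
apply: smooth_onZ.
  apply: smooth_onM; first exact: (smooth_on_comp sb smooth_on_conformal_factor).
  apply: smooth_onV; first exact: smooth_on_vlast.
  by move=> Q /BA /chart_pos /lt0r_neq0.
apply: (@smooth_on_row_mx _ _ 1 m).
  apply: (smooth_on_lin_comp (l := fun c : R => c%:M : 'rV_1)).
    by move=> a u v; rewrite scale_scalar_mx raddfD.
  exact: smooth_onN.
apply: smooth_onB; last exact: smooth_onZ.
apply: smooth_onZ => //; apply: smooth_onM; last exact: smooth_on_cst.
by apply: smooth_onD => //; exact: smooth_on_cst.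
Qed.

Lemma smooth_on_spun_inv : smooth_on (spun_map @` B) spun_inv.
Proof.
set M := _ @` B; have [_ sG imF KF] := DF.
have Mun q : M q -> exists Q, [/\ A (chart_base Q), B Q,
    unspin q = (F (chart_base Q), stereo 1 (rsubmx Q.1.2)) & q = spun_map Q].
  by move=> [Q BQ <-]; exists Q; split=> //; [exact: BA|exact: unspin_spun_map].
have su : smooth_on M (@unspin R k m).
  by apply: smooth_onW (@smooth_on_unspin R k m) => _ [Q BQ <-]; exact: spun_map_tail.
have id0 : smooth_on M (fun q : X => q) by exact: smooth_on_id.
have id1 : smooth_on M (fun q : X => q.1) by exact: smooth_on_fst.
have id12 : smooth_on M (fun q : X => q.1.2) by exact: smooth_on_snd.
have sp : smooth_on M (fun q => (unspin q).1 : V) by exact: smooth_on_fst.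
have ss : smooth_on M (fun q => (unspin q).2 : W) by exact: smooth_on_snd.
have sp1 : smooth_on M (fun q => (unspin q).1.1) by exact: smooth_on_fst.
have sp11 : smooth_on M (fun q => (unspin q).1.1.1) by exact: smooth_on_fst.
have sp12 : smooth_on M (fun q => (unspin q).1.1.2) by exact: smooth_on_snd.
have sq : smooth_on M (fun q => G (unspin q).1).
  apply: (smooth_on_comp sp sG) => q /Mun[Q [AQ _ -> _]] /=.
  by rewrite -imF; exists (chart_base Q).
have sq1 : smooth_on M (fun q => (G (unspin q).1).1) by exact: smooth_on_fst.
have qA q : M q -> A (G (unspin q).1).
  by move=> /Mun[Q [AQ _ -> _]] /=; rewrite KF.
have sf : smooth_on M (fun q => conformal_factor (G (unspin q).1)).
  exact: (smooth_on_comp sq smooth_on_conformal_factor).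
have sth : smooth_on M (fun q => unstereo 1 (unspin q).2 : 'rV_m).
  apply: smooth_on_unstereo => // q /Mun[Q [AQ _ -> _]] /=.
  by apply: stereo_den_neq0; rewrite mulr1.
have sK : smooth_on M (fun q : X =>
    (vlast (unspin q).1.1.1 / conformal_factor (G (unspin q).1)) *:
    (rsubmx q.1.2 - vlast (unspin q).1.1.2 *: (unspin q).2)).
  apply: smooth_onZ.
    apply: smooth_onM; first exact: smooth_on_vlast.
    by apply: smooth_onV => // q /qA; exact: conformal_factor_neq0.
  apply: smooth_onB; first exact: smooth_on_rsubmx.
  by apply: smooth_onZ => //; exact: smooth_on_vlast.
apply: smooth_on_pair; last first.
  apply: smooth_on_row_mx; first exact: smooth_on_snd.
  apply: smooth_onZ.
    apply: smooth_onM; first exact: smooth_on_cst.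
    apply: smooth_onV; last by move=> q _; rewrite lt0r_neq0 // stereo_den_gt0.
    by apply: smooth_onD; [exact: smooth_on_cst|exact: smooth_on_dot].
  apply: smooth_onB; first exact: (@smooth_on_rsubmx _ _ 1 m).
  by apply: smooth_onZ => //; exact: smooth_on_coord.
apply: smooth_on_pair; first exact: smooth_on_fst.
by apply: smooth_on_row_mx => //; exact: smooth_on_snd.
Qed.

Lemma diffeo_spun : diffeo B (spun_map @` B) spun_map spun_inv.
Proof.
split=> //; [exact: smooth_on_spun_map|exact: smooth_on_spun_inv|exact: spun_mapK].
Qed.

Lemma chart_base_lin : linear chart_base.
Proof.
move=> c u v; apply: (f_equal2 pair); last by rewrite /= linearP.
by apply: (f_equal2 pair) => //=; rewrite linearP.
Qed.

Lemma chart_form_base Q v :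
  chart_form (chart_base Q) (chart_base v) - dot (rsubmx Q.2) (rsubmx v.1.2) =
  chart_form Q v.
Proof.
rewrite /chart_form /ch_q /ch_ys /ch_xs /= -addrA -opprD -dot_row_mx.
by rewrite !hsubmxK.
Qed.

Lemma cform_spun Q v : B Q ->
  cform (spun_map Q) ('d spun_map Q v) =
  conformal_factor (chart_base Q) * chart_form Q v.
Proof.
move=> BQ; have AQ := BA BQ.
pose f (Q' : Z2) : V := F (chart_base Q').
pose th (Q' : Z2) : 'rV[R]_m := rsubmx Q'.1.2.
pose g (Q' : Z2) : W := stereo 1 (th Q').
have thl : linear th by move=> c u w; rewrite /th /= linearP.
have dth : differentiable th Q by exact: differentiable_lin.
have db : differentiable chart_base Q.
  by apply: differentiable_lin; exact: chart_base_lin.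
have dF := chart_differentiable AQ.
have df : differentiable f Q by exact: (differentiable_comp db dF).
have dst : differentiable (fun u : 'rV[R]_m => stereo 1 u : W) (th Q).
  exact: (smooth_on_differentiable (smooth_on_stereo1 R m) (I : setT (th Q))).
have dg : differentiable g Q by exact: (differentiable_comp dth dst).
have fE : 'd f Q v = 'd F (chart_base Q) (chart_base v).
  apply: etrans (diff_comp_at v db dF) _; congr ('d F _ _).
  by apply: diff_lin_at; exact: chart_base_lin.
have gE : 'd g Q v = 'd (fun u : 'rV[R]_m => stereo 1 u : W) (th Q) (th v).
  apply: etrans (diff_comp_at v dth dst) _.
  have E : 'd th Q v = th v by exact: diff_lin_at.
  by apply: (@eq_ind_r _ _ (fun x => _ x = _) _ _ E).
have [dP E1 E2] := diff_spin_pt v df dg.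
have dS := smooth_on_differentiable smooth_on_spun_map BQ.
have dS1 : differentiable (fun Q' => (spun_map Q').1) Q by exact: differentiable_fst.
have dP1 : differentiable (fun Q' => (spin_pt (f Q') (g Q')).1) Q.
  exact: differentiable_fst.
set ds := 'd g Q v in E1 gE *; set dp := 'd f Q v in E1 E2 fE *.
have S1 : ('d spun_map Q v).1.1 =
    row_mx (vinit dp.1.1) (vlast dp.1.1 *: g Q + vlast (f Q).1.1 *: ds).
  by rewrite (diff_fst _ dS) (diff_fst _ dS1) -E1 (diff_fst _ dP) (diff_fst _ dP1).
have S2 : ('d spun_map Q v).2 = dp.2.
  by rewrite (diff_snd _ dS) -E2 (diff_snd _ dP).
have gg : dot (g Q) (g Q) = 1 by exact: stereo1_dot.
have gds : dot (g Q) ds = 0.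
  apply: dot_diff_unit => //.
  by apply: (open_near openT (I : setT Q)) => Q' _; exact: stereo1_dot.
have C1 := cform_spin gg gds S1 S2.
(* The shift occurs only among the slopes, so it adds a single pairing with the [x]-part of the
   tangent vector. The radial half of that pairing vanishes by orthogonality, and the other half
   gives the missing term of [chart_form]. *)
have -> : cform (spun_map Q) ('d spun_map Q v) =
    cform (spin_pt (f Q) (g Q)) ('d spun_map Q v) -
    dot (row_mx 0 (fibre_shift Q)) ('d spun_map Q v).1.1.
  by rewrite /cform dotDl opprD addrA.
have zg : dot (fibre_shift Q) (g Q) = 0 by rewrite dotC dot_fibre_shift.
rewrite C1 S1 dot_row_mx dotC dot0r add0r dotDr (dotZr (vlast dp.1.1) _ (g Q)) zg.
rewrite mulr0 add0r (dotZr (vlast (f Q).1.1) _ ds) dotZl gE.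
rewrite dot_cotangent_diff fE cform_chart // -chart_form_base.
rewrite mulrA [vlast _ * _]mulrC divfK; last by rewrite lt0r_neq0 // chart_pos.
by rewrite [RHS]mulrBr /th.
Qed.

End SpunChart.

(** * Looseness of the spun Legendrian *)

Section LooseSpin.
Variables (R : realType) (k m : nat).

(** The dimension [d] is a variable because [(k + m.+1).-1] is not convertible to [k + m]. *)
Lemma loose_of_chart n d (L : set (cspace R n)) (a b c : R)
    (lambda0 : set (R * R * R)) (U : set (cspace R n)) :
  d = n.-1 -> 0 < a -> 0 < b -> 0 < c -> a < b * c -> zigzag a lambda0 ->
  contactomorphic (@chart_form R d) (@cform R n) (@loose_box R d a b c)
    (@loose_core R d b lambda0) U (U `&` L) -> loose L.
Proof. by move=> -> a0 b0 c0 abc zz H; exists a, b, c, lambda0, U. Qed.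

Lemma loose_core_box d (a b c : R) (lambda0 : set (R * R * R)) :
  0 < c -> zigzag a lambda0 ->
  @loose_core R d b lambda0 `<=` @loose_box R d a b c.
Proof.
move=> c0 [x [y [z [t1 [t2 [[_ [cube _ _ _] _ _ _] ->]]]]]] q [[t It tq] xb y0].
split=> //; first by rewrite -tq; exact: cube.
by rewrite y0 /enorm dot0r sqrtr0 ltW.
Qed.

Lemma cotangent0 (th : 'rV[R]_m) : cotangent th 0 = 0.
Proof.
rewrite /cotangent dot0r oppr0 scaler0 scale0r subr0.
apply/rowP => i; rewrite !mxE; case: fintype.splitP => j _; rewrite !mxE //.
by case: (_ == _); rewrite ?mulr1n ?mulr0n.
Qed.

Lemma loose_spin (L U : set (cspace R k.+1)) (a b c : R)
    (lambda0 : set (R * R * R)) :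
  0 < a -> 0 < b -> 0 < c -> a < b * c -> zigzag a lambda0 ->
  (forall p, L p -> 0 < vlast p.1.1) -> (forall p, U p -> 0 < vlast p.1.1) ->
  contactomorphic (@chart_form R k) (@cform R k.+1) (@loose_box R k a b c)
    (@loose_core R k b lambda0) U (U `&` L) ->
  loose (front_spin m L).
Proof.
move=> a0 b0 c0 abc zz L0 U0 [F [G [DF imF cF]]].
have [sF sG imFU KF] := DF.
pose B := @loose_box R (k + m) a b c.
have BA Q : B Q -> @loose_box R k a b c (chart_base Q).
  by move=> [q x y]; split=> //; exact: le_trans (enorm_lsubmx _) _.
pose H := @spun_map R k m F.
apply: (@loose_of_chart (k + m.+1) (k + m) _ a b c lambda0 (H @` B)) => //.
  by rewrite addnS.
have DH := diffeo_spun DF cF U0 BA.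
exists H, (spun_inv F G); split; first exact: DH.
- apply/seteqP; split=> [_ [Q CQ <-]|_ [[Q BQ <-] /front_spinP[p [s [Lp ss E]]]]].
    have BQ : B Q by exact: (loose_core_box c0 zz CQ).
    split; first by exists Q.
    have [lq xb y0] := CQ; have AQ := BA Q BQ.
    have : (U `&` L) (F (chart_base Q)).
      rewrite -imF; exists (chart_base Q) => //; split=> //.
        exact: le_trans (enorm_lsubmx _) xb.
      by rewrite /ch_ys /= -[Q.2]/(ch_ys Q) y0 linear0.
    move=> [_ LF]; apply/front_spinP.
    exists (F (chart_base Q)), (stereo 1 (rsubmx Q.1.2)); split=> //.
      exact: stereo1_dot.
    rewrite /H /spun_map /fibre_shift -[Q.2]/(ch_ys Q) y0 linear0 cotangent0.
    by rewrite scaler0 row_mx0 addr0.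
  have AQ := BA Q BQ.
  (* Now a point of the chart that lies on the spun Legendrian. [unspin] ignores the shift and so
     identifies both the point of [L] and the point of the sphere. *)
  have [UE1 UE2] : F (chart_base Q) = p /\ stereo 1 (rsubmx Q.1.2) = s.
    have := unspin_spun_map DF U0 BA BQ.
    by rewrite -/(H Q) E unspinK ?L0 // => -[-> ->].
  have UF : (U `&` L) (F (chart_base Q)).
    by split; [rewrite -imFU; exists (chart_base Q)|rewrite UE1].
  (* With these identified, the slopes of [H Q] and of the spun point can differ by the shift
     only. *)
  have z0 : fibre_shift F Q = 0.
    have : (H Q).1.2 = (spin_pt p s).1.2 by rewrite E.
    rewrite -UE1 -UE2 /H /spun_map /= add_row_mx addr0 => /eq_row_mx[_].
    by move/eqP; rewrite -subr_eq0 addrAC subrr add0r => /eqP.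
  have e0 : rsubmx Q.2 = 0.
    rewrite -(cotangentK (rsubmx Q.1.2) (rsubmx Q.2)).
    move/eqP: z0; rewrite /fibre_shift scaler_eq0 mulf_eq0 invr_eq0.
    rewrite (negbTE (conformal_factor_neq0 DF cF AQ)).
    rewrite gt_eqF ?(chart_pos DF U0 AQ) //= => /eqP ->.
    exact: uncotangent0.
  move: UF; rewrite -imF => -[q Cq qE].
  (* Injectivity of [F] on the box puts [chart_base Q] itself into the smaller core. The arc
     condition and the vanishing of the old [ys] come from there, the bound on [xs] from the larger
     box. *)
  have qQ : q = chart_base Q.
    by rewrite -[q]KF ?qE ?KF //; exact: (loose_core_box c0 zz Cq).
  exists Q => //; have [lq xb _] := BQ; move: Cq; rewrite qQ => -[l1 _ y1].
  split=> //; rewrite /ch_ys -[Q.2]hsubmxK e0.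
  by move: y1; rewrite /ch_ys /= => ->; rewrite row_mx0.
- move=> Q v BQ; have E := cform_spun DF cF U0 BA v BQ.
  split=> [cv|]; first by apply: etrans E _; rewrite cv mulr0.
  move=> cv; have : conformal_factor F (chart_base Q) * chart_form Q v = 0.
    exact: etrans (esym E) cv.
  move/eqP; rewrite mulf_eq0 (negbTE (conformal_factor_neq0 DF cF (BA Q BQ))).
  by move/eqP.
Qed.

End LooseSpin.

Theorem proposition1p13 (R : realType) (k m : nat) (hk : (1 < k.+1)%N)
  (hm : (1 <= m)%N) (L : set (cspace R k.+1)) (t : R) :
  legendrian L -> loose L ->
  (forall p, (xtranslate t @` L) p -> 0 < vlast p.1.1) ->
  legendrian (front_spin m (xtranslate t @` L)) /\
  loose (front_spin m (xtranslate t @` L)).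
Proof.
move=> lL [a [b [c [lambda0 [U [[a0 b0 c0] abc zz ch]]]]]] L0.
have [_ cL _ _ _] := lL; split.
  by apply: legendrian_spin => //; exact: legendrian_xtranslate.
have Lt p : L p -> 0 < vlast p.1.1 + t.
  move=> Lp; have := L0 (xtranslate t p); rewrite /xtranslate /= vlast_delta; apply.
  by exists p.
(* Translating the chart along with [L] would not suffice: its domain could still meet the region
   where the last coordinate is not positive. *)
have [U' U'0 ch'] := push_chart ch cL Lt.
exact: (loose_spin m a0 b0 c0 abc zz L0 U'0 ch').
Qed.
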